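(* (i) There is an absolute constant $C>0$ such that for all $p_1,p_2,q\in(0,1]$ the following fixed strategies guarantee a synchronization time $X$ with $\mathbb{E}X\le C/(p_1p_2q^2)$: Alice uses the geometric distribution with parameter $p_2q/6$ over her open channels $\{i:A_i=1\}$, and Bob uses the geometric distribution with parameter $p_1q/6$ over his open channels $\{i:B_i=1\}$. Furthermore, for every fixed $\epsilon>0$ there are fixed strategies for Alice and Bob which do not require knowledge of $p_1,p_2,q$ and a constant $C_\epsilon>0$ depending only on $\epsilon$ such that, for all $p_1,p_2,q\in(0,1]$, $$\mathbb{E}X\le \frac{C_\epsilon}{p_1p_2q^2}\,\log^{2+\epsilon}\Big(\frac{e}{p_1p_2q}\Big).$$ These are obtained by taking $\mu_a(\text{the } j\text{-th open channel of Alice})=\mu_b(\text{the } j\text{-th open channel of Bob})\propto \dfrac{1}{j\,\log^{1+\epsilon/2}(j+1)}$ for $j=1,2,\ldots$. (ii) There is an absolute constant $c>0$ such that for all $p_1,p_2,q\in(0,1]$, every choice of stationary strategies by Alice and Bob satisfies $\mathbb{E}X\ge c/(p_1p_2q^2)$.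
   Context: Synchronization problem. Channels are indexed by $\mathbb{N}=\{1,2,\ldots\}$. Let $p_1,p_2,q\in(0,1]$. The environments are $A=(A_i)_{i\in\mathbb N}$ (Alice), $B=(B_i)_{i\in\mathbb N}$ (Bob), $E=(E_i)_{i\in\mathbb N}$ (Eve), where all the variables $A_i,B_i,E_i$ are mutually independent Bernoulli variables with $\mathbb{P}(A_i=1)=p_1$, $\mathbb{P}(B_i=1)=p_2$, $\mathbb{P}(E_i=1)=q$. The value $1$ means that the channel is open in that environment. The environments do not change over time. Strategies. In each time slot each party selects one channel, at random. Alice knows $A$ but not $B,E$; Bob knows $B$ but not $A,E$. There is no feedback before synchronization, so strategies are non-adaptive: Alice's strategy assigns to each realization of $A$ the law of a random sequence of channels $(a_t)_{t\ge1}$, and Bob's strategy assigns to each realization of $B$ the law of a random sequence of channels $(b_t)_{t\ge1}$. The parties use independent private randomness, so that, conditionally on $(A,B,E)$, the sequences $(a_t)$ and $(b_t)$ are independent, the law of $(a_t)$ depends only on $A$ and the law of $(b_t)$ depends only on $B$. Strategies may depend on $p_1,p_2,q$ unless stated otherwise. Write $\mu_a^t$ for the conditional law of $a_t$ given $A$, and $\mu_b^t$ for the conditional law of $b_t$ given $B$. A strategy is stationary if the law of the selected channel is the same in every time slot, i.e. $\mu_a^t=\mu_a^1=:\mu_a$ for all $t$ (respectively $\mu_b^t=\mu_b^1=:\mu_b$ for all $t$); selections in different time slots may be dependent. A strategy is fixed if, given the local environment, the selections in different time slots are independent with one common law $\mu_a$ (respectively $\mu_b$). Synchronization time. Bob may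 have already made $s\ge 0$ selections when Alice starts. The parties synchronize at time $t\ge 1$ if $a_t=b_{s+t}=j$ for some channel $j$ with $A_j=B_j=E_j=1$. Thus the conditional probability given $(A,B,E)$ of a successful sync at time $t$ is $\sum_j \mu_a^t(j)\mu_b^{s+t}(j)A_jB_jE_j$. The synchronization time $X$ is the first time $t\ge1$ at which the parties synchronize ($X=\infty$ if there is none). $\mathbb{E}X$ is the expectation over $A,B,E$ and over the randomness of the strategies. The bounds are for every $s\ge0$. Geometric distribution with parameter $\theta$ over a set of open channels: the $j$-th open channel in increasing order ($j=1,2,\ldots$) receives probability $(1-\theta)^{j-1}\theta$. (Almost surely each party has infinitely many open channels.) *)

(* Defs.v *)
From mathcomp Require Import all_boot all_order all_algebra.
From mathcomp Require Import all_classical all_reals all_analysis.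

Set Implicit Arguments.
Unset Strict Implicit.
Unset Printing Implicit Defensive.

Import Order.TTheory GRing.Theory Num.Theory.
Import numFieldNormedType.Exports.
Local Open Scope classical_set_scope.
Local Open Scope ring_scope.

(* The natural number i stands for the channel i + 1, and index t of a sequence
   of selections stands for the time slot t + 1. *)

Definition cylinders d (T : measurableType d) : set (set (nat -> T)) :=
  \bigcup_i preimage_set_system setT (fun x : nat -> T => x i) measurable.

Arguments cylinders {d} T.

(* [nat -> T] with its product sigma-algebra *)
Definition seq_space d (T : measurableType d) : Type :=
  g_sigma_algebraType (cylinders T).

Definition env : Type := seq_space bool.
Definition selections : Type := seq_space nat.

(* T is bool or nat below, so every U t is measurable. Taking U t = setT for some
   t shows that initial segments of coordinates cover every finite subfamily. *)
Definition independent_coordinates (R : realType) (T : Type)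
    (P : set (nat -> T) -> \bar R) : Prop :=
  forall (n : nat) (U : nat -> set T),
    P [set x | forall t, (t < n)%N -> U t (x t)] =
    (\prod_(t < n) P [set x | U t (x t)])%E.

Definition bernoulli_env (R : realType) (p : R) (P : probability env R) : Prop :=
  independent_coordinates P /\ forall i : nat, P [set A | A i] = p%:E.

(* The value at A is the conditional law of the whole sequence of selections
   given that the local environment is A. *)
Definition strategy (R : realType) : Type := R.-pker env ~> selections.

Definition slot_law (R : realType) (k : strategy R) (t : nat) (A : env)
    (U : set nat) : \bar R :=
  k A [set a | U (a t)].

Definition stationary (R : realType) (k : strategy R) : Prop :=
  forall (A : env) (t : nat), slot_law k t A = slot_law k 0 A.

Definition fixed (R : realType) (k : strategy R) : Prop :=
  stationary k /\ forall A : env, independent_coordinates (k A).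

(* If A i holds, then i is the [open_rank A i]-th open channel of A, counting
   from 1. *)
Definition open_rank (A : env) (i : nat) : nat := (\sum_(k < i.+1) A k)%N.

(* The condition concerns the first slot only, and is meant for fixed
   strategies. Environments with finitely many open channels form a null set
   and are left unconstrained. *)
Definition plays_weights (R : realType) (w : nat -> R) (k : strategy R) : Prop :=
  forall A : env, infinite_set [set i | A i] ->
    forall i : nat,
      slot_law k 0 A [set i] = (if A i then w (open_rank A i) else 0)%:E.

Definition geometric_weight (R : realType) (theta : R) (j : nat) : R :=
  (1 - theta) ^+ j.-1 * theta.

Definition log_weight_raw (R : realType) (eps : R) (j : nat) : R :=
  (j%:R * ln j.+1%:R `^ (1 + eps / 2))^-1.

Definition log_weight (R : realType) (eps : R) (j : nat) : R :=
  log_weight_raw eps j / limn (fun n => \sum_(1 <= i < n) log_weight_raw eps i).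

Definition synced (A B E : env) (s : nat) (a b : selections) (t : nat) : Prop :=
  a t = b (s + t)%N /\ [/\ A (a t), B (a t) & E (a t)].

(* The infimum of the empty set is +oo. *)
Definition sync_time (R : realType) (A B E : env) (s : nat)
    (a b : selections) : \bar R :=
  ereal_inf [set (t.+1%:R)%:E | t in synced A B E s a b].

(* A, B, E are independent with laws PA, PB, PE, and given (A, B, E) the two
   sequences of selections are independent with laws ka A and kb B. *)
Definition expected_sync_time (R : realType) (PA PB PE : probability env R)
    (ka kb : strategy R) (s : nat) : \bar R :=
  (\int[PA]_A \int[PB]_B \int[PE]_E \int[ka A]_a \int[kb B]_b
     sync_time R A B E s a b)%E.

(* Main.v *)
Require Import Defs.
From HB Require Import structures.
From mathcomp Require Import all_boot all_order all_algebra.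
From mathcomp Require Import all_classical all_reals all_analysis.
From mathcomp Require Import measurable_realfun ring lra.

Set Implicit Arguments.
Unset Strict Implicit.
Unset Printing Implicit Defensive.

Import Order.TTheory GRing.Theory Num.Theory.
Import numFieldNormedType.Exports.
Local Open Scope classical_set_scope.
Local Open Scope ring_scope.

(* Call a channel good if it is open for Alice, Bob and Eve, and put
   u = p2 q, v = p1 q, p = p1 p2 q.

   Upper bounds. The parties have synchronized once both select the first good
   channel L in the same slot, which takes 1 / (w1(a) w2(b)) slots on average,
   where a and b are the ranks of L among the open channels of Alice and of
   Bob. These ranks are geometric variables with parameters u and v, so that
   E z^a = 3/2 for z = 1 / (1 - u/3), and similarly for b. Hence a bound
   1 / (w1(i) w2(j)) <= K (z1^i + z2^j) gives E X <= 4 K; by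
   2 x y <= x^2 + y^2 it holds for both weight sequences with the right K.

   Lower bound. Let x_j be the probability that channel j is open for Alice and
   selected by her in a given slot. At most 1 / (4p) channels are heavy, in the
   sense that x_j > 4p, so with probability at least 3/4 none of them is good.
   The probability of a synchronization on a channel that is not heavy is at
   most 4 p q in each slot. By the union bound there is no synchronization
   before time 1 / (16 p q) with probability at least 1/2. *)

(** The obstacle is that [sync_time] is an infimum nested in five iterated integrals. It is compared
    pointwise with measurable functions, and [le_integral_nonneg] carries each comparison through
    the integrals. For the upper bound these functions are series of products over channels, since
    products are what independence of coordinates allows one to integrate. The series runs over
    every candidate L for the first good channel, and the term of the true one dominates.
    Environments with finitely many good channels are covered by a further series that diverges
    there. In the lower bound the mean success probability per slot is too crude: if both parties
    prefer one fixed channel it is at least p, although the target order is p q. Such a success is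
    concentrated on a rare event of the environment, and this event is isolated by the heavy
    channels. On its complement only the success probability of a single slot enters, so dependence
    between slots is harmless. *)

Section nonmeasurable_monotonicity.
Import HBNNSimple.

(* The integral of a nonnegative function is a supremum over simple functions,
   so no measurability is needed. *)
Lemma le_integral_nonneg d (T : measurableType d) (R : realType)
    (mu : {measure set T -> \bar R}) (f g : T -> \bar R) :
  (forall x, 0 <= f x)%E -> (forall x, f x <= g x)%E ->
  (\int[mu]_x f x <= \int[mu]_x g x)%E.
Proof.
move=> f0 fg.
have g0 x : (0 <= g x)%E by exact: le_trans (fg x).
rewrite !ge0_integralTE//; apply: ereal_sup_le => _ [h hf <-].
by exists h => // x; exact: le_trans (hf x) (fg x).
Qed.

End nonmeasurable_monotonicity.

Lemma nneseries_single (R : realType) (f : nat -> \bar R) (k : nat) :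
  (0 <= f k)%E -> (forall i, i != k -> f i = 0%E) ->
  (\sum_(i <oo) f i = f k)%E.
Proof.
move=> fk0 f0.
rewrite (@nneseriesD1 _ _ k)//; last first.
  by move=> i _; have [->//|/f0 ->] := eqVneq i k.
by rewrite eseries0 ?adde0// => i _ /= /f0.
Qed.

(** * Sequence spaces and products of functions of independent coordinates *)

Section measurable_coordinates.
Context d (T : measurableType d).
Hypothesis mT : forall U : set T, measurable U.

Lemma measurable_coord (t : nat) d' (Y : measurableType d') (g : T -> Y) :
  measurable_fun setT (fun x : seq_space T => g (x t)).
Proof.
move=> _ U mU; rewrite setTI; apply: sub_sigma_algebra.
by exists t => //; exists (g @^-1` U) => //; rewrite setTI.
Qed.

Lemma measurable_coord_set (t : nat) (U : set T) :
  measurable [set x : seq_space T | U (x t)].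
Proof.
by apply: sub_sigma_algebra; exists t => //; exists U => //; rewrite setTI.
Qed.

Lemma measurable_box (n : nat) (U : nat -> set T) :
  measurable [set x : seq_space T | forall t, (t < n)%N -> U t (x t)].
Proof.
rewrite (_ : mkset _ = \bigcap_(t in [set t | (t < n)%N])
    [set x : seq_space T | U t (x t)])//.
by apply: bigcap_measurableType => t _; exact: measurable_coord_set.
Qed.

Lemma measurable_prod_coord (R : realType) (n : nat) (f : nat -> T -> R) :
  measurable_fun setT (fun x : seq_space T => \prod_(t < n) f t (x t)).
Proof.
elim: n => [|n IH].
  rewrite (_ : (fun x : seq_space T => _) = cst 1)//.
  by apply/funext => x; rewrite big_ord0.
rewrite (_ : (fun x : seq_space T => _) =
    (fun x => \prod_(t < n) f t (x t) * f n (x n))).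
  by apply: measurable_funM => //; exact: measurable_coord.
by apply/funext => x; rewrite big_ord_recr.
Qed.

End measurable_coordinates.

Section coordinates.
Context d (T : measurableType d) (R : realType).
Hypothesis mT : forall U : set T, measurable U.
Variables (pk : T -> nat) (pk_inj : injective pk).
Variable P : {measure set (seq_space T) -> \bar R}.
Hypothesis indP : independent_coordinates P.

Lemma independent_coordinates_setT : P setT = 1%E.
Proof.
by have := indP 0 (fun=> setT); rewrite big_ord0 => <-; congr (P _); apply/seteqP.
Qed.

Let le1 (A : set (seq_space T)) : measurable A -> (P A <= 1)%E.
Proof. by move=> mA; rewrite -independent_coordinates_setT le_measure ?inE. Qed.

Let box_indic n (U : nat -> set T) (x : seq_space T) :
  \prod_(t < n) \1_(U t) (x t) =
  \1_[set x : seq_space T | forall t, (t < n)%N -> U t (x t)] x :> R.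
Proof.
rewrite indicE; have [/set_mem Ux|/negP nU] := boolP (x \in _).
  by rewrite big1// => t _; rewrite indicE mem_set//; exact: Ux.
have [[t /= tU]|H] := pselect (exists t : 'I_n, ~ U t (x t)).
  by rewrite (bigD1 t)//= indicE memNset// mul0r.
exfalso; apply: nU; apply/mem_set => t tn; apply: contrapT => nUt; apply: H.
by exists (Ordinal tn).
Qed.

Lemma integral_coord_indic (t : nat) (U : set T) :
  (\int[P]_x (\1_U (x t))%:E = P [set x : seq_space T | U (x t)])%E.
Proof.
rewrite (eq_integral (fun x => (\1_[set x : seq_space T | U (x t)] x)%:E)).
  by rewrite integral_indic ?setIT//; exact: measurable_coord_set.
by move=> x _; rewrite !indicE; congr (_%:R%:E); rewrite !inE.
Qed.

(* The factors f t are replaced one by one by combinations of indicators of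
   points; independence of coordinates settles the case of indicators. *)
Let integral_prod_coord_rec (n m : nat) : (m <= n)%N ->
  forall (f : nat -> T -> R) (I : nat -> R) (U : nat -> set T),
  (forall t y, 0 <= f t y) ->
  (forall t, \int[P]_x (f t (x t))%:E = (I t)%:E)%E ->
  (forall t, (m <= t)%N -> f t = \1_(U t)) ->
  (\int[P]_x (\prod_(t < n) f t (x t))%:E = (\prod_(t < n) I t)%:E)%E.
Proof.
elim: m => [_ f I U f0 fI fU|m IH mn f I U f0 fI fU].
  under eq_integral => x _.
    under eq_bigr => t _ do rewrite fU//.
    rewrite box_indic; over.
  rewrite integral_indic//; last exact: measurable_box.
  rewrite setIT indP -prodEFin; apply: eq_bigr => t _.
  by rewrite -fI; under eq_integral => x _ do rewrite fU//; rewrite integral_coord_indic.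
pose V k := [set y | pk y = k].
(* By injectivity of [pk] the fibre [V k] has at most one point. If it is empty, [get] returns a
   default, but the indicator multiplying [c k] vanishes. *)
pose c k := f m (get (V k)).
have VE k y : f m y * \1_(V k) y = c k * \1_(V k) y.
  rewrite indicE; have [/set_mem Vky|] := boolP (y \in _); last by rewrite !mulr0.
  by rewrite /c; congr (f m _ * _); apply: pk_inj; rewrite (getI Vky).
pose g k t := if t == m then \1_(V k) else f t.
pose p k := P [set x | V k (x m)].
have pfin k : p k \is a fin_num.
  rewrite ge0_fin_numE// (le_lt_trans (le1 _))// ?ltry//.
  exact: measurable_coord_set.
pose J k t := if t == m then fine (p k) else I t.
have V1 k : (\int[P]_x (\1_(V k) (x m))%:E = (fine (p k))%:E)%E.
  by rewrite fineK// integral_coord_indic.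
have gI k : (\int[P]_x (\prod_(t < n) g k t (x t))%:E =
    (\prod_(t < n) J k t)%:E)%E.
  apply: (IH (ltnW mn) _ _ (fun t => if t == m then V k else U t)).
  - by move=> t y; rewrite /g; case: eqP.
  - by move=> t; rewrite /g /J; case: eqP => [->|].
  - move=> t mt; rewrite /g; case: eqP => // /eqP tm.
    by rewrite fU// ltn_neqAle eq_sym tm.
pose m' := Ordinal mn.
have fE (x : seq_space T) : ((\prod_(t < n) f t (x t))%:E =
    \sum_(k <oo) (c k * \prod_(t < n) g k t (x t))%:E)%E.
  rewrite (@nneseries_single _ _ (pk (x m))).
  - rewrite (bigD1 m')//= [in RHS](bigD1 m')//= /g eqxx mulrA -VE.
    rewrite indicE mem_set// mulr1; congr (_ * _)%:E.
    by apply: eq_bigr => t tm; rewrite ifN.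
  - rewrite lee_fin mulr_ge0// ?/c//; apply: prodr_ge0 => t _.
    by rewrite /g; case: eqP.
  - move=> k kx; rewrite (bigD1 m')//= /g eqxx indicE memNset ?mul0r ?mulr0//.
    by move=> xk; rewrite -xk eqxx in kx.
pose C := \prod_(t < n | t != m') I t.
have C0 : 0 <= C.
  apply: prodr_ge0 => t _; rewrite -lee_fin -fI.
  by apply: integral_ge0 => x _; rewrite lee_fin.
under eq_integral => x _ do rewrite fE.
rewrite integral_nneseries//; last 2 first.
- move=> k; apply/measurable_EFinP; apply: measurable_funM => //.
  exact: measurable_prod_coord.
- move=> k x _; rewrite lee_fin mulr_ge0// ?/c//; apply: prodr_ge0 => t _.
  by rewrite /g; case: eqP.
(* The induction hypothesis splits each summand into [C] and an integral of coordinate m alone;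
   summing over k then restores the integral of [f m]. *)
transitivity (\sum_(k <oo) (C%:E * \int[P]_x (c k * \1_(V k) (x m))%:E))%E.
  apply: eq_eseriesr => k _.
  under eq_integral => x _ do rewrite EFinM.
  rewrite ge0_integralZl_EFin//; last 3 first.
  - by move=> x _; rewrite lee_fin; apply: prodr_ge0 => t _; rewrite /g; case: eqP.
  - by apply/measurable_EFinP; exact: measurable_prod_coord.
  - exact: f0.
  under [in RHS]eq_integral => x _ do rewrite EFinM.
  rewrite ge0_integralZl_EFin//; last 2 first.
  - by apply/measurable_EFinP; exact: measurable_coord.
  - exact: f0.
  rewrite gI V1 -!EFinM; congr EFin; rewrite mulrCA; congr (_ * _).
  rewrite (bigD1 m')//= /J eqxx mulrC; congr (_ * _).
  by apply: eq_bigr => t tm; rewrite ifN.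
rewrite nneseriesZl//; last first.
  by move=> k _; apply: integral_ge0 => x _; rewrite lee_fin mulr_ge0 ?f0.
rewrite -integral_nneseries//; last 2 first.
- by move=> k; apply/measurable_EFinP; apply: measurable_funM => //; exact: measurable_coord.
- by move=> k x _; rewrite lee_fin mulr_ge0 ?f0.
rewrite [in RHS](bigD1 m')//= [in RHS]mulrC EFinM -/C -fI; congr (_ * _)%E.
apply: eq_integral => x _; rewrite (@nneseries_single _ _ (pk (x m))).
- by rewrite -VE indicE mem_set// mulr1.
- by rewrite lee_fin mulr_ge0 ?f0.
- move=> k kx; rewrite indicE memNset ?mulr0//.
  by move=> xk; rewrite -xk eqxx in kx.
Qed.

Lemma integral_prod_coord (n : nat) (f : nat -> T -> R) (I : nat -> R) :
  (forall t y, 0 <= f t y) ->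
  (forall t, \int[P]_x (f t (x t))%:E = (I t)%:E)%E ->
  (\int[P]_x (\prod_(t < n) f t (x t))%:E = (\prod_(t < n) I t)%:E)%E.
Proof.
(* The recursion asks for indicators from index n on, beyond the range of the product; the constant
   1 is one. *)
move=> f0 fI; pose g t := if (t < n)%N then f t else \1_setT.
have : (\int[P]_x (\prod_(t < n) g t (x t))%:E =
    (\prod_(t < n) (if (t < n)%N then I t else 1))%:E)%E.
  apply: (@integral_prod_coord_rec _ _ (leqnn n) g
    (fun t => if (t < n)%N then I t else 1) (fun=> setT)).
  - by move=> t y; rewrite /g; case: ifP.
  - move=> t; rewrite /g; case: ifP => // _.
    rewrite (eq_integral (cst 1%E)).
      by rewrite integral_cst// independent_coordinates_setT mul1e.
    by move=> x _; rewrite indicT.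
  - by move=> t; rewrite /g leqNgt => /negbTE ->.
rewrite /g; under [in RHS]eq_bigr => t _ do rewrite ltn_ord.
move=> <-; apply: eq_integral => x _; congr EFin.
by apply: eq_bigr => t _; rewrite ltn_ord.
Qed.

(** Handles the s selections that Bob made before Alice starts: padding with s constant factors 1
    reduces it to the unshifted product. *)
Lemma integral_prod_coord_shift (s n : nat) (f : nat -> T -> R) (I : nat -> R) :
  (forall t y, 0 <= f t y) ->
  (forall t, \int[P]_x (f t (x (s + t)%N))%:E = (I t)%:E)%E ->
  (\int[P]_x (\prod_(t < n) f t (x (s + t)%N))%:E = (\prod_(t < n) I t)%:E)%E.
Proof.
move=> f0 fI; pose g t := if (t < s)%N then cst 1 else f (t - s)%N.
have : (\int[P]_x (\prod_(t < s + n) g t (x t))%:E =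
    (\prod_(t < s + n) (if (t < s)%N then 1 else I (t - s)%N))%:E)%E.
  apply: (@integral_prod_coord (s + n) g (fun t => if (t < s)%N then 1 else I (t - s)%N)).
  - by move=> t y; rewrite /g; case: ifP => //= _.
  - move=> t; rewrite /g; case: ltnP => st.
      rewrite (eq_integral (cst 1%E))//.
      by rewrite integral_cst// independent_coordinates_setT mul1e.
    by rewrite -fI subnKC.
have E (F : nat -> R) :
    \prod_(t < s + n) (if (t < s)%N then 1 else F t) = \prod_(t < n) F (s + t)%N.
  rewrite big_split_ord/= big1 ?mul1r; last by move=> t _; rewrite ltn_ord.
  by apply: eq_bigr => t _; rewrite ltnNge leq_addr.
rewrite (E (fun t => I (t - s)%N)); under [in RHS]eq_bigr do rewrite addKn.
move=> <-; apply: eq_integral => x _; congr EFin.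
transitivity (\prod_(t < s + n) (if (t < s)%N then 1 else f (t - s)%N (x t))).
  rewrite (E (fun t => f (t - s)%N (x t))).
  by apply: eq_bigr => t _; rewrite addKn.
by apply: eq_bigr => t _; rewrite /g; case: ifP.
Qed.

End coordinates.

(** * Expected time until both parties select one given good channel *)

Lemma geometric_nneseries_le (R : realType) (r : R) : 0 <= r < 1 ->
  (\sum_(n <oo) (r ^+ n)%:E <= ((1 - r)^-1)%:E)%E.
Proof.
move=> /andP[r0 r1]; apply: lime_le.
  by apply: is_cvg_nneseries => n _ _; rewrite lee_fin exprn_ge0.
apply: nearW => n; rewrite sumEFin lee_fin big_mkord.
rewrite -[leRHS]mul1r ler_pdivlMr ?subr_gt0// mulrC -opprB mulNr -subrX1 opprB.
by rewrite gerBl exprn_ge0.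
Qed.

(** Makes a dominating series infinite in the degenerate cases, when the parties never meet on the
    given channel or the good channels run out. *)
Lemma nneseries_eq_pinfty (R : realType) (c : R) (f : nat -> \bar R) : 0 < c ->
  (forall n, 0 <= f n)%E -> (forall m, exists2 n, (m <= n)%N & (c%:E <= f n)%E) ->
  (\sum_(n <oo) f n = +oo)%E.
Proof.
move=> c0 f0 f1; apply/eqyP => e e0.
have H (m : nat) : exists N, ((m%:R * c)%:E <= \sum_(0 <= n < N) f n)%E.
  elim: m => [|m [N IH]]; first by exists 0%N; rewrite big_nil mul0r.
  have [n Nn fn] := f1 N; exists n.+1.
  rewrite big_nat_recr//= -natr1 mulrDl mul1r EFinD; apply: leeD => //.
  apply: (le_trans IH); rewrite [leRHS](big_cat_nat (n := N))//=.
  by rewrite leeDl// sume_ge0.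
have [N HN] := H (Num.truncn (e / c)).+1.
apply: (le_trans _ (nneseries_lim_ge N _)); last by [].
by apply: le_trans HN; rewrite lee_fin -ler_pdivrMr// ltW// truncnS_gt.
Qed.

(** Used twice: for Bob with c the 0-1 indicator of Alice's selection, then for Alice with c = y. *)
Lemma integral_coord_affine (R : realType) (P : {measure set selections -> \bar R})
    (L t : nat) (x c : R) :
  P setT = 1%E -> P [set a | a t = L] = x%:E -> 0 <= c <= 1 ->
  (\int[P]_a (1 - (a t == L)%:R * c)%:E = (1 - x * c)%:E)%E.
Proof.
move=> P1 Px /andP[c0 c1].
pose U := [set j | j <> L].
have PU : P [set a | U (a t)] = (1 - x)%:E.
  rewrite (_ : [set a | U (a t)] = ~` [set a | a t = L])//.
  have mA : measurable [set a : selections | a t = L].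
    exact: (@measurable_coord_set _ nat (fun=> I) t [set L]).
  have H : (1 = x%:E + P (~` [set a | a t = L]))%E.
    have M := measureU P mA (measurableC mA) (setICr _).
    have W := etrans (esym P1) (congr1 P (esym (setUv [set a | a t = L]))).
    exact: etrans (etrans W M) (congr1 (fun z => z + _)%E Px).
  have : P (~` [set a | a t = L]) \is a fin_num.
    rewrite ge0_fin_numE// (@le_lt_trans _ _ 1%E)// ?ltry// -P1 le_measure// ?inE//.
    exact: measurableC.
  move=> /fineK K; rewrite -K in H *; rewrite -EFinD in H.
  by case: H => ->; rewrite addrC addKr.
(* A combination with nonnegative coefficients, so that additivity of the integral applies to
   nonnegative terms. *)
have E (a : selections) : (1 - (a t == L)%:R * c)%:E = ((1 - c)%:E + c%:E * (\1_U (a t))%:E)%E.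
  rewrite -EFinM -EFinD indicE; congr EFin; case: eqP => aL.
    by rewrite memNset ?mul1r ?mulr0 ?addr0 => [|/(_ aL)].
  by rewrite mem_set// mul0r subr0 mulr1 subrK.
under eq_integral do rewrite E.
have mU : measurable_fun setT (fun a : selections => (\1_U (a t))%:E : \bar R).
  by apply/measurable_EFinP;
    exact: (@measurable_coord _ nat (fun=> I) t _ _ (fun j => \1_U j : R)).
rewrite ge0_integralD//; last 3 first.
- by move=> a _; rewrite lee_fin subr_ge0.
- by move=> a _; rewrite -EFinM lee_fin mulr_ge0.
- exact: measurable_funeM.
rewrite integral_cst// ge0_integralZl_EFin//.
rewrite (@integral_coord_indic _ nat _ (fun=> I)) PU P1 mule1 -EFinM -EFinD.
by congr EFin; ring.
Qed.

Section conditional_upper_bound.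
Context (R : realType).
Variables (mu nu : {measure set selections -> \bar R}).
Hypotheses (indmu : independent_coordinates mu) (indnu : independent_coordinates nu).
Variables (L : nat) (x y : R).
Hypotheses (x0 : 0 < x) (y0 : 0 < y).
Hypothesis mux : forall t, mu [set a | a t = L] = x%:E.
Hypothesis nuy : forall t, nu [set b | b t = L] = y%:E.

(** The 0-1 indicator that the parties do not meet on L in the first n slots. Its sum over n is the
    time of the first such meeting, counted from 1. *)
Let miss (s n : nat) (a b : selections) : R :=
  \prod_(t < n) (1 - (b (s + t)%N == L)%:R * (a t == L)%:R).

Let factor_ge0 (u v : bool) : 0 <= 1 - u%:R * v%:R :> R.
Proof. by rewrite subr_ge0; case: u; case: v; rewrite ?mulr0 ?mul0r ?mulr1. Qed.

Let miss_ge0 s n a b : 0 <= miss s n a b.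
Proof. by apply: prodr_ge0 => t _; exact: factor_ge0. Qed.

Let miss1 s n a b : (forall t, (t < n)%N -> ~ (a t = L /\ b (s + t)%N = L)) ->
  miss s n a b = 1.
Proof.
move=> H; rewrite /miss big1// => t _.
have := H t (ltn_ord t); case: eqP => [->|]; last by rewrite mul0r subr0.
by case: eqP => [->|]; [tauto|rewrite mulr0 subr0].
Qed.

Let sync_le_miss (A B E : env) s a b : A L -> B L -> E L ->
  (sync_time R A B E s a b <= \sum_(n <oo) (miss s n a b)%:E)%E.
Proof.
move=> AL BL EL.
have m0 n : (0 <= (miss s n a b)%:E)%E by rewrite lee_fin.
have [[t0 ht0]|H] := pselect (exists t, (a t == L) && (b (s + t)%N == L)).
  have ex : exists t, (a t == L) && (b (s + t)%N == L) by exists t0.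
  case: (ex_minnP ex) => t /andP[/eqP aL /eqP bL] tmin.
  apply: (@le_trans _ _ (t.+1%:R)%:E).
    apply: ereal_inf_lbound; exists t => //; split; first by rewrite aL bL.
    by rewrite aL.
  apply: (le_trans _ (nneseries_lim_ge t.+1 _)); last by [].
  rewrite (eq_big_nat _ _ (F2 := fun=> 1%E)).
    by rewrite sumEFin sumr_const_nat subn0.
  move=> n /andP[_ nt]; congr EFin; apply: miss1 => u un [ua ub].
  have := tmin u; rewrite ua ub !eqxx => /(_ isT).
  by rewrite leqNgt (leq_trans un).
rewrite (@nneseries_eq_pinfty _ 1) ?leey// => m; exists m => //.
rewrite miss1// => t _ [ta tb]; apply: H; exists t.
by rewrite ta tb !eqxx.
Qed.

Let mu1 := independent_coordinates_setT indmu.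
Let nu1 := independent_coordinates_setT indnu.

Let ley1 : y <= 1.
Proof.
rewrite -lee_fin -(nuy 0) -nu1 le_measure// ?inE//.
exact: (@measurable_coord_set _ nat (fun=> I) 0 [set L]).
Qed.

Let lex1 : x <= 1.
Proof.
rewrite -lee_fin -(mux 0) -mu1 le_measure// ?inE//.
exact: (@measurable_coord_set _ nat (fun=> I) 0 [set L]).
Qed.

Let int_nu (s n : nat) (a : selections) :
  (\int[nu]_b (miss s n a b)%:E = (\prod_(t < n) (1 - y * (a t == L)%:R))%:E)%E.
Proof.
apply: (@integral_prod_coord_shift _ nat _ (fun=> I) id _ _ indnu s n
  (fun t j => 1 - (j == L)%:R * (a t == L)%:R)
  (fun t => 1 - y * (a t == L)%:R)) => // t.
by apply: integral_coord_affine => //; case: (_ == _); rewrite /= ?ler01 ?lexx.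
Qed.

Let int_mu (n : nat) :
  (\int[mu]_a (\prod_(t < n) (1 - y * (a t == L)%:R))%:E =
   ((1 - x * y) ^+ n)%:E)%E.
Proof.
have -> : (1 - x * y) ^+ n = \prod_(t < n) (1 - x * y).
  by rewrite prodr_const card_ord.
apply: (@integral_prod_coord _ nat _ (fun=> I) id _ _ indmu n
  (fun t j => 1 - y * (j == L)%:R) (fun t => 1 - x * y)) => //.
  by move=> t j; rewrite subr_ge0; case: (_ == _); rewrite /= ?mulr1 ?mulr0.
move=> t; under eq_integral do rewrite [y * _]mulrC.
by apply: integral_coord_affine => //; rewrite ley1 ltW.
Qed.

(** Integrating the tail sum, first over Bob with Alice's selections frozen and then over Alice,
    turns its n-th term into (1 - x y)^n. *)
Lemma conditional_sync_time_le (A B E : env) (s : nat) : A L -> B L -> E L ->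
  (\int[mu]_a \int[nu]_b sync_time R A B E s a b <= ((x * y)^-1)%:E)%E.
Proof.
move=> AL BL EL.
have X0 a b : (0 <= sync_time R A B E s a b)%E.
  by apply: le_ereal_inf_tmp => _ [t _ <-]; rewrite lee_fin.
have p0 n (a : selections) : 0 <= \prod_(t < n) (1 - y * (a t == L)%:R).
  by apply: prodr_ge0 => t _; rewrite subr_ge0; case: (_ == _); rewrite /= ?mulr1 ?mulr0.
have mmiss n a : measurable_fun setT (fun b : selections => (miss s n a b)%:E).
  apply/measurable_EFinP.
  pose f u j : R := if (u < s)%N then 1 else 1 - (j == L)%:R * (a (u - s)%N == L)%:R.
  rewrite (_ : miss s n a = (fun b : selections => \prod_(u < s + n) f u (b u))).
    exact: (@measurable_prod_coord _ nat (fun=> I) R).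
  apply/funext => b; rewrite big_split_ord/= [X in _ = X * _]big1 ?mul1r.
    by apply: eq_bigr => t _; rewrite /f ltnNge leq_addr/= addKn.
  by move=> t _; rewrite /f ltn_ord.
apply: (@le_trans _ _ (\int[mu]_a \int[nu]_b (\sum_(n <oo) (miss s n a b)%:E))%E).
  apply: le_integral_nonneg => a; first by apply: integral_ge0.
  by apply: le_integral_nonneg => // b; exact: sync_le_miss.
under eq_integral => a _.
  rewrite integral_nneseries//; last by move=> n b _; rewrite lee_fin.
  under eq_eseriesr do rewrite int_nu.
  over.
rewrite integral_nneseries//; last 2 first.
- by move=> n; apply/measurable_EFinP; exact: (@measurable_prod_coord _ nat (fun=> I) R
    n (fun t j => 1 - y * (j == L)%:R)).
- by move=> n a _; rewrite lee_fin.
under eq_eseriesr do rewrite int_mu.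
have xy : 0 < x * y <= 1 by rewrite mulr_gt0// mulr_ile1// ltW.
case/andP: xy => xy0 xy1.
apply: le_trans (geometric_nneseries_le _) _.
  by rewrite subr_ge0 xy1 ltrBlDr ltrDl.
by rewrite opprB addrC subrK.
Qed.

End conditional_upper_bound.

(** * Averaging functions that factor over channels *)

Definition avg (R : realType) (p : R) (f : bool -> R) : R :=
  p * f true + (1 - p) * f false.

Lemma avg_ge0 (R : realType) (p : R) (f : bool -> R) :
  0 <= p <= 1 -> (forall b, 0 <= f b) -> 0 <= avg p f.
Proof.
by move=> /andP[p0 p1] f0; rewrite addr_ge0// mulr_ge0// subr_ge0.
Qed.

Lemma bernoulli_env_prob (R : realType) (p : R) (P : probability env R) (t : nat) :
  bernoulli_env p P -> P [set x | x t = true] = p%:E.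
Proof. by case=> _ /(_ t). Qed.

Lemma integral_bernoulli (R : realType) (p : R) (P : probability env R) (t : nat)
    (f : bool -> R) : bernoulli_env p P -> (forall b, 0 <= f b) ->
  (\int[P]_x (f (x t))%:E = (avg p f)%:E)%E.
Proof.
move=> bP f0.
have fE (x : env) : (f (x t))%:E =
    ((f true)%:E * (\1_[set true] (x t))%:E + (f false)%:E * (\1_[set false] (x t))%:E)%E.
  rewrite -!EFinM -EFinD; congr EFin; rewrite !indicE !in_set1.
  by case: (x t); rewrite /= ?mulr1 ?mulr0 ?addr0 ?add0r.
under eq_integral do rewrite fE.
have m (b : bool) : measurable_fun setT (fun x : env => (\1_[set b] (x t))%:E : \bar R).
  by apply/measurable_EFinP;
    exact: (@measurable_coord _ bool (fun=> I) t _ _ (fun j => \1_[set b] j : R)).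
rewrite ge0_integralD//; last 4 first.
- by move=> x _; rewrite -EFinM lee_fin mulr_ge0.
- by apply: measurable_funeM; exact: m.
- by move=> x _; rewrite -EFinM lee_fin mulr_ge0.
- by apply: measurable_funeM; exact: m.
rewrite !ge0_integralZl_EFin//.
rewrite !(@integral_coord_indic _ bool _ (fun=> I)).
have mt : measurable [set x : env | x t = true].
  exact: (@measurable_coord_set _ bool (fun=> I) t [set true]).
transitivity ((f true)%:E * p%:E + (f false)%:E * (1 - p)%:E)%E; last first.
  by rewrite -!EFinM -EFinD /avg; congr EFin; ring.
congr (_ * _ + _ * _)%E; first exact: (bernoulli_env_prob t bP).
rewrite (_ : mkset _ = ~` [set x | x t = true]).
  by apply: etrans (probability_setC P mt) _; rewrite (bernoulli_env_prob t bP).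
by apply/seteqP; split => x /=; [move=> ->|case: (x t)].
Qed.

Section three_environments.
Context (R : realType) (p1 p2 q : R) (PA PB PE : probability env R).
Hypotheses (hp1 : 0 < p1 <= 1) (hp2 : 0 < p2 <= 1) (hq : 0 < q <= 1).
Hypotheses (bA : bernoulli_env p1 PA) (bB : bernoulli_env p2 PB).
Hypothesis (bE : bernoulli_env q PE).

(** The shape of all integrands in the upper bound: the mean of such a product is the product of the
    Bernoulli means [avg3]. *)
Definition prod3 (h : nat -> bool -> bool -> bool -> R) (n : nat)
    (x : env * (env * env)) : R :=
  \prod_(k < n) h k (x.1 k) (x.2.1 k) (x.2.2 k).

Definition avg3 (f : bool -> bool -> bool -> R) : R :=
  avg p1 (fun a => avg p2 (fun b => avg q (f a b))).

Let mcoord1 (k : nat) : measurable_fun setT (fun x : env * (env * env) => x.1 k).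
Proof.
apply: (measurableT_comp (f := fun A : env => A k)); last exact: measurable_fst.
exact: (@measurable_coord _ bool (fun=> I) k _ _ id).
Qed.

Let mcoord2 (k : nat) : measurable_fun setT (fun x : env * (env * env) => x.2.1 k).
Proof.
have m : measurable_fun setT (fun x : env * (env * env) => x.2.1).
  exact: (measurableT_comp (@measurable_fst _ _ env env)
    (@measurable_snd _ _ env (env * env)%type)).
exact: (measurableT_comp (@measurable_coord _ bool (fun=> I) k _ _ id) m).
Qed.

Let mcoord3 (k : nat) : measurable_fun setT (fun x : env * (env * env) => x.2.2 k).
Proof.
have m : measurable_fun setT (fun x : env * (env * env) => x.2.2).
  exact: (measurableT_comp (@measurable_snd _ _ env env)
    (@measurable_snd _ _ env (env * env)%type)).
exact: (measurableT_comp (@measurable_coord _ bool (fun=> I) k _ _ id) m).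
Qed.

Let mif (c : env * (env * env) -> bool) (f g : env * (env * env) -> R) :
  measurable_fun setT c -> measurable_fun setT f -> measurable_fun setT g ->
  measurable_fun setT (fun x => if c x then f x else g x).
Proof. by move=> mc mf mg; exact: measurable_fun_ifT. Qed.

Lemma measurable_prod3 h n : measurable_fun setT (prod3 h n).
Proof.
rewrite /prod3; elim: n => [|n IH].
  rewrite (_ : (fun x : env * (env * env) => _) = cst 1)//.
  by apply/funext => x; rewrite big_ord0.
(* A function of three bits is unfolded into nested conditionals on single coordinates, whose
   measurability is known. *)
rewrite (_ : (fun x : env * (env * env) => _) = (fun x =>
  \prod_(k < n) h k (x.1 k) (x.2.1 k) (x.2.2 k) *
  (if x.1 n then if x.2.1 n then if x.2.2 n then h n true true true
    else h n true true false else if x.2.2 n then h n true false true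
    else h n true false false else if x.2.1 n then if x.2.2 n then h n false true true
    else h n false true false else if x.2.2 n then h n false false true
    else h n false false false))); last first.
  apply/funext => x; rewrite big_ord_recr/=; congr (_ * _).
  by case: (x.1 n); case: (x.2.1 n); case: (x.2.2 n).
apply: measurable_funM; first exact: IH.
apply: mif; first exact: mcoord1.
  apply: mif; first exact: mcoord2.
    by apply: mif; [exact: mcoord3|exact: measurable_cst..].
  by apply: mif; [exact: mcoord3|exact: measurable_cst..].
apply: mif; first exact: mcoord2.
  by apply: mif; [exact: mcoord3|exact: measurable_cst..].
by apply: mif; [exact: mcoord3|exact: measurable_cst..].
Qed.

Definition prod_env : subprobability (env * (env * env))%type R :=
  product_subprobability (PA : subprobability _ R,
    product_subprobability (PB : subprobability _ R, PE : subprobability _ R)).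

(** On one product measure a series is exchanged with the integral once instead of at each of three
    levels. *)
Lemma integral_prod_measure3 (f : env * (env * env) -> \bar R) :
  measurable_fun setT f -> (forall x, 0 <= f x)%E ->
  (\int[PA]_A \int[PB]_B \int[PE]_E f (A, (B, E)) =
   \int[prod_env]_x f x)%E.
Proof.
move=> mf f0; rewrite [RHS](@fubini_tonelli1 _ _ _ _ R PA (product_subprobability
  (PB : subprobability _ R, PE : subprobability _ R)) f mf)//.
apply: eq_integral => A _; apply/esym.
apply: (@fubini_tonelli1 _ _ _ _ R PB PE (fun y => f (A, y))) => //.
exact: measurable_fun_pair2.
Qed.

Lemma integral_prod3 h n : (forall k a b e, 0 <= h k a b e) ->
  (\int[prod_env]_x (prod3 h n x)%:E = (\prod_(k < n) avg3 (h k))%:E)%E.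
Proof.
move=> h0.
have q01 : 0 <= q <= 1 by case/andP: hq => /ltW -> ->.
have p201 : 0 <= p2 <= 1 by case/andP: hp2 => /ltW -> ->.
have p101 : 0 <= p1 <= 1 by case/andP: hp1 => /ltW -> ->.
rewrite -integral_prod_measure3; last 2 first.
- by apply/measurable_EFinP; exact: measurable_prod3.
- by move=> x; rewrite lee_fin; exact: prodr_ge0.
have [iA _] := bA; have [iB _] := bB; have [iE _] := bE.
have injb : injective nat_of_bool by case; case.
under eq_integral => A _.
  under eq_integral => B _.
    rewrite /prod3/= (@integral_prod_coord _ bool _ (fun=> I) _ injb _ iE n
      (fun k e => h k (A k) (B k) e) (fun k => avg q (h k (A k) (B k))))//; last first.
      by move=> t; exact: integral_bernoulli.
    over.
  rewrite /= (@integral_prod_coord _ bool _ (fun=> I) _ injb _ iB n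
    (fun k b => avg q (h k (A k) b))
    (fun k => avg p2 (fun b => avg q (h k (A k) b))))//; last 2 first.
    by move=> t b; exact: avg_ge0.
    by move=> t; apply: (integral_bernoulli t bB) => b; exact: avg_ge0.
  over.
rewrite /= (@integral_prod_coord _ bool _ (fun=> I) _ injb _ iA n
    (fun k a => avg p2 (fun b => avg q (h k a b))) (fun k => avg3 (h k)))//.
  by move=> t a; apply: avg_ge0 => // b; exact: avg_ge0.
by move=> t; apply: (integral_bernoulli t bA) => a; apply: avg_ge0 => // b; exact: avg_ge0.
Qed.


End three_environments.

(** * Upper bound averaged over the environments *)

Lemma open_rank_gt0 (A : env) (i : nat) : A i -> (0 < open_rank A i)%N.
Proof. by move=> Ai; rewrite /open_rank big_ord_recr/= Ai addn1. Qed.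

Lemma infinite_set_unbounded (D : set nat) :
  (forall m, exists2 k, (m <= k)%N & D k) -> infinite_set D.
Proof.
move=> H /finite_seqP[s Ds].
have [k sk Dk] := H (\max_(i <- s) i).+1.
have ks : k \in s by move: Dk; rewrite Ds.
have : (k <= \max_(i <- s) i)%N by exact: leq_bigmax_seq.
by rewrite leqNgt sk.
Qed.

Lemma slot_law_stationary (R : realType) (k : strategy R) (A : env) (t L : nat) :
  stationary k -> k A [set a | a t = L] = slot_law k 0 A [set L].
Proof. by move=> sk; rewrite -(sk A t). Qed.

Section upper_bound.
Context (R : realType) (p1 p2 q K : R) (w1 w2 : nat -> R) (ka kb : strategy R).
Context (PA PB PE : probability env R).
Hypotheses (hp1 : 0 < p1 <= 1) (hp2 : 0 < p2 <= 1) (hq : 0 < q <= 1) (K0 : 0 < K).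
Hypotheses (fka : fixed ka) (fkb : fixed kb).
Hypotheses (wka : plays_weights w1 ka) (wkb : plays_weights w2 kb).
Hypotheses (w10 : forall i, (0 < i)%N -> 0 < w1 i) (w20 : forall i, (0 < i)%N -> 0 < w2 i).
Let z1 : R := (1 - p2 * q / 3)^-1.
Let z2 : R := (1 - p1 * q / 3)^-1.
Hypothesis w12 : forall i j, (0 < i)%N -> (0 < j)%N ->
  (w1 i * w2 j)^-1 <= K * (z1 ^+ i + z2 ^+ j).

(** The product over k up to and including L is the indicator that L is the first good channel,
    times [z1] to the rank of L for Alice. The same holds for [h2] with Bob. *)
Let h1 (L k : nat) (a b e : bool) : R :=
  (if (k < L)%N then (~~ [&& a, b & e])%:R else [&& a, b & e]%:R) * z1 ^+ a.
Let h2 (L k : nat) (a b e : bool) : R :=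
  (if (k < L)%N then (~~ [&& a, b & e])%:R else [&& a, b & e]%:R) * z2 ^+ b.
(* The product of the h3 L k over k < 2 L indicates that no channel in [L, 2L[
   is good. If there are finitely many good channels, this is 1 for all large L,
   and the series of these indicators diverges. *)
Let h3 (L k : nat) (a b e : bool) : R :=
  if (k < L)%N then 1 else (~~ [&& a, b & e])%:R.

(** The factor p1 p2 q normalizes the last term: its means form a geometric series of total K. *)
Let F (L : nat) (x : env * (env * env)) : R :=
  K * prod3 (h1 L) L.+1 x + K * prod3 (h2 L) L.+1 x
  + K * (p1 * p2 * q) * prod3 (h3 L) (L + L) x.

Let p0 : 0 < p1 * p2 * q.
Proof.
by case/andP: hp1 hp2 hq => ? _ /andP[? _] /andP[? _]; rewrite !mulr_gt0.
Qed.

Let u1 : 0 < p2 * q <= 1.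
Proof.
case/andP: hp2 hq => ? ? /andP[? ?]; rewrite mulr_gt0//=.
by rewrite mulr_ile1// ltW.
Qed.

Let u2 : 0 < p1 * q <= 1.
Proof.
case/andP: hp1 hq => ? ? /andP[? ?]; rewrite mulr_gt0//=.
by rewrite mulr_ile1// ltW.
Qed.

Let z10 : 0 < z1.
Proof. by rewrite invr_gt0; case/andP: u1 => ? ?; lra. Qed.

Let z20 : 0 < z2.
Proof. by rewrite invr_gt0; case/andP: u2 => ? ?; lra. Qed.

Let F10 L x : 0 <= prod3 (h1 L) L.+1 x.
Proof.
by apply: prodr_ge0 => k _; apply: mulr_ge0;
  [rewrite /h1; case: ifP; rewrite ler0n|rewrite exprn_ge0// ltW].
Qed.

Let F20 L x : 0 <= prod3 (h2 L) L.+1 x.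
Proof.
by apply: prodr_ge0 => k _; apply: mulr_ge0;
  [rewrite /h2; case: ifP; rewrite ler0n|rewrite exprn_ge0// ltW].
Qed.

Let F30 L x : 0 <= prod3 (h3 L) (L + L) x.
Proof. by apply: prodr_ge0 => k _; rewrite /h3; case: ifP. Qed.

Let F0 L x : 0 <= F L x.
Proof.
have K0' := ltW K0; have p0' := ltW p0.
by rewrite /F !addr_ge0//; apply: mulr_ge0 => //; apply: mulr_ge0.
Qed.

Let F1E L A B E : (forall k, (k < L)%N -> ~~ [&& A k, B k & E k]) ->
  [&& A L, B L & E L] -> prod3 (h1 L) L.+1 (A, (B, E)) = z1 ^+ open_rank A L.
Proof.
move=> nG GL; rewrite /prod3 /open_rank -prodrXr; apply: eq_bigr => k _ /=.
rewrite /h1; case: ltnP => kL; first by rewrite nG// mul1r.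
by rewrite (_ : nat_of_ord k = L) ?GL ?mul1r//; apply/eqP; rewrite eqn_leq kL -ltnS ltn_ord.
Qed.

Let F2E L A B E : (forall k, (k < L)%N -> ~~ [&& A k, B k & E k]) ->
  [&& A L, B L & E L] -> prod3 (h2 L) L.+1 (A, (B, E)) = z2 ^+ open_rank B L.
Proof.
move=> nG GL; rewrite /prod3 /open_rank -prodrXr; apply: eq_bigr => k _ /=.
rewrite /h2; case: ltnP => kL; first by rewrite nG// mul1r.
by rewrite (_ : nat_of_ord k = L) ?GL ?mul1r//; apply/eqP; rewrite eqn_leq kL -ltnS ltn_ord.
Qed.

(** If good channels are unbounded, both parties have infinitely many open channels, so
    [plays_weights] applies, and the term at the first good channel alone suffices. *)
Let conditional_le s A B E :
  (\int[ka A]_a \int[kb B]_b sync_time R A B E s a b <=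
   \sum_(L <oo) (F L (A, (B, E)))%:E)%E.
Proof.
have F0' L : (0 <= (F L (A, (B, E)))%:E)%E by rewrite lee_fin.
have [H|] := pselect (forall m, exists2 k, (m <= k)%N & [&& A k, B k & E k]); last first.
  move=> /existsNP[m /forall2NP Hm].
  rewrite (@nneseries_eq_pinfty _ (K * (p1 * p2 * q))) ?leey//; first exact: mulr_gt0.
  move=> n; exists (maxn m n); first exact: leq_maxr.
  rewrite lee_fin /F; set L := maxn m n.
  have -> : prod3 (h3 L) (L + L) (A, (B, E)) = 1.
    apply: big1 => k _; rewrite /h3; case: ltnP => // Lk /=.
    by case: (Hm k) => [|/negP -> //]; rewrite (leq_trans (leq_maxl m n) Lk).
  by rewrite mulr1 lerDr addr_ge0// mulr_ge0// ltW.
have iA : infinite_set [set i | A i].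
  by apply: infinite_set_unbounded => m; have [k mk /and3P[]] := H m; exists k.
have iB : infinite_set [set i | B i].
  by apply: infinite_set_unbounded => m; have [k mk /and3P[]] := H m; exists k.
have ex : exists L, [&& A L, B L & E L] by have [k _] := H 0; exists k.
case: (ex_minnP ex) => L GL Lmin.
have nG k : (k < L)%N -> ~~ [&& A k, B k & E k].
  by move=> kL; apply/negP => /Lmin; rewrite leqNgt kL.
have /and3P[AL BL EL] := GL.
apply: (le_trans (conditional_sync_time_le (fka.2 A) (fkb.2 B) (L := L) (x := w1 (open_rank A L))
    (y := w2 (open_rank B L)) _ _ _ _ s AL BL EL)).
- exact/w10/open_rank_gt0.
- exact/w20/open_rank_gt0.
- by move=> t; rewrite (slot_law_stationary _ _ _ fka.1) wka// AL.
- by move=> t; rewrite (slot_law_stationary _ _ _ fkb.1) wkb// BL.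
apply: (@le_trans _ _ (F L (A, (B, E)))%:E).
  rewrite lee_fin (le_trans (w12 (open_rank_gt0 AL) (open_rank_gt0 BL)))//.
  by rewrite /F F1E// F2E// -mulrDr lerDl mulr_ge0// mulr_ge0// ltW.
apply: (le_trans _ (nneseries_lim_ge L.+1 _)) => //.
by rewrite big_nat_recr//= leeDr// sume_ge0.
Qed.

Hypotheses (bA : bernoulli_env p1 PA) (bB : bernoulli_env p2 PB).
Hypothesis (bE : bernoulli_env q PE).

(** The mean factor of a channel before L: with u = p2 q it is 1 - p1 + p1 (1 - u) z1, and z1 = 1 /
    (1 - u / 3) gives this form. *)
Let rho1 := 1 - (p1 * (2 * (p2 * q) / 3)) * z1.
Let rho2 := 1 - (p2 * (2 * (p1 * q) / 3)) * z2.

Let rho_bound (u : R) (c : R) : 0 < u <= 1 -> 0 < c <= 1 ->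
  0 <= 1 - (c * (2 * u / 3)) * (1 - u / 3)^-1 < 1.
Proof.
move=> /andP[u0 ule] /andP[c0 c1].
have d0 : 0 < 1 - u / 3 by lra.
rewrite subr_ge0 ltrBlDr ltrDl ler_pdivrMr// mul1r.
apply/andP; split; last by rewrite mulr_gt0// ?invr_gt0// mulr_gt0//; lra.
by apply: (@le_trans _ _ (1 * (2 * u / 3))); [apply: ler_wpM2r => //; lra|lra].
Qed.

(** With z = 1 / (1 - u / 3), summing gives c u z divided by c (2 u / 3) z, and everything but 3/2
    cancels. *)
Let geometric_part (u c p : R) : 0 < u <= 1 -> 0 < c <= 1 -> p = c * u ->
  (\sum_(L <oo) (p * (1 - u / 3)^-1 *
     (1 - (c * (2 * u / 3)) * (1 - u / 3)^-1) ^+ L)%:E <= (3 / 2)%:E)%E.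
Proof.
move=> hu hc ->; have /andP[r0 r1] := rho_bound hu hc.
have d0 : 0 < 1 - u / 3 by case/andP: hu; lra.
have [u0 c0] : 0 < u /\ 0 < c by case/andP: hu hc => ? _ /andP[].
set r := 1 - _ * _ in r0 r1 *; set g := c * u * _.
have g0 : 0 < g by rewrite !mulr_gt0// invr_gt0.
under eq_eseriesr do rewrite EFinM.
rewrite nneseriesZl; last by move=> i _; rewrite lee_fin exprn_ge0.
apply: (@le_trans _ _ (g%:E * ((1 - r)^-1)%:E)%E).
  apply: lee_wpmul2l; first by rewrite lee_fin ltW.
  by apply: geometric_nneseries_le; rewrite r0.
rewrite -EFinM lee_fin /r /g subKr.
rewrite le_eqVlt; apply/orP; left; apply/eqP; field.
by rewrite !gt_eqF//=; lra.
Qed.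

Let J1 L : (\int[prod_env PA PB PE]_x (prod3 (h1 L) L.+1 x)%:E =
   (p1 * p2 * q * z1 * rho1 ^+ L)%:E)%E.
Proof.
rewrite (integral_prod3 hp1 hp2 hq bA bB bE); last first.
  by move=> k a b e; apply: mulr_ge0;
  [rewrite /h1; case: ifP; rewrite ler0n|rewrite exprn_ge0// ltW].
congr EFin; rewrite big_ord_recr/= mulrC; congr (_ * _).
  by rewrite /h1 ltnn /avg3 /avg /= !expr0 !expr1; ring.
have -> : rho1 ^+ L = \prod_(k < L) rho1 by rewrite prodr_const card_ord.
apply: eq_bigr => k _; rewrite /h1 ltn_ord /avg3 /avg /= !expr0 !expr1 /rho1.
rewrite /z1; field; case/andP: u1 => ? ?; lra.
Qed.

Let J2 L : (\int[prod_env PA PB PE]_x (prod3 (h2 L) L.+1 x)%:E =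
   (p1 * p2 * q * z2 * rho2 ^+ L)%:E)%E.
Proof.
rewrite (integral_prod3 hp1 hp2 hq bA bB bE); last first.
  by move=> k a b e; apply: mulr_ge0;
  [rewrite /h2; case: ifP; rewrite ler0n|rewrite exprn_ge0// ltW].
congr EFin; rewrite big_ord_recr/= mulrC; congr (_ * _).
  by rewrite /h2 ltnn /avg3 /avg /= !expr0 !expr1; ring.
have -> : rho2 ^+ L = \prod_(k < L) rho2 by rewrite prodr_const card_ord.
apply: eq_bigr => k _; rewrite /h2 ltn_ord /avg3 /avg /= !expr0 !expr1 /rho2.
rewrite /z2; field; case/andP: u2 => ? ?; lra.
Qed.

Let J3 L : (\int[prod_env PA PB PE]_x (prod3 (h3 L) (L + L) x)%:E =
   ((1 - p1 * p2 * q) ^+ L)%:E)%E.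
Proof.
rewrite (integral_prod3 hp1 hp2 hq bA bB bE); last first.
  by move=> k a b e; rewrite /h3; case: ifP.
congr EFin; rewrite big_split_ord/= big1 ?mul1r.
  rewrite -[RHS]mul1r; have -> : (1 - p1 * p2 * q) ^+ L = \prod_(k < L) (1 - p1 * p2 * q).
    by rewrite prodr_const card_ord.
  rewrite mul1r; apply: eq_bigr => k _.
  by rewrite /h3 ltnNge leq_addr /avg3 /avg /=; ring.
by move=> k _; rewrite /h3 ltn_ord /avg3 /avg /=; ring.
Qed.

Lemma expected_sync_time_le s :
  (expected_sync_time PA PB PE ka kb s <= (4 * K)%:E)%E.
Proof.
pose S : env * (env * env) -> \bar R := fun x => (\sum_(L <oo) (F L x)%:E)%E.
have mF L : measurable_fun setT (fun x => (F L x)%:E).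
  by apply/measurable_EFinP; apply: measurable_funD; [apply: measurable_funD|];
    apply: measurable_funM => //; exact: measurable_prod3.
have S0 x : (0 <= S x)%E by apply: nneseries_ge0 => n _ _; rewrite lee_fin.
have mS : measurable_fun setT S.
  apply: ge0_emeasurable_sum => // k x _ _.
  by rewrite lee_fin.
apply: (@le_trans _ _ (\int[PA]_A \int[PB]_B \int[PE]_E S (A, (B, E)))%E).
  have X0 A B E : (0 <= \int[ka A]_a \int[kb B]_b sync_time R A B E s a b)%E.
    apply: integral_ge0 => a _; apply: integral_ge0 => b _.
    by apply: le_ereal_inf_tmp => _ [t _ <-]; rewrite lee_fin.
  apply: le_integral_nonneg => A; first by do 2 (apply: integral_ge0 => ? _).
  apply: le_integral_nonneg => B; first by apply: integral_ge0.
  by apply: le_integral_nonneg => E; [exact: X0|exact: conditional_le].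
rewrite integral_prod_measure3// /S integral_nneseries//; last by move=> n x _; rewrite lee_fin.
have JF L : (\int[prod_env PA PB PE]_x (F L x)%:E =
    K%:E * (p1 * p2 * q * z1 * rho1 ^+ L)%:E + K%:E * (p1 * p2 * q * z2 * rho2 ^+ L)%:E
    + (K * (p1 * p2 * q))%:E * ((1 - p1 * p2 * q) ^+ L)%:E)%E.
  have m (h : nat -> nat -> bool -> bool -> bool -> R) n :
      measurable_fun setT (fun x => (prod3 (h L) n x)%:E).
    by apply/measurable_EFinP; exact: measurable_prod3.
  have hK := ltW K0; have hp := ltW p0.
  under eq_integral do rewrite /F !EFinD (EFinM K) (EFinM K) (EFinM (K * _)).
  rewrite ge0_integralD//; last 4 first.
  - by move=> x _; rewrite -!EFinM -EFinD lee_fin addr_ge0// mulr_ge0.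
  - by apply: emeasurable_funD; apply: measurable_funeM; exact: m.
  - by move=> x _; rewrite -!EFinM lee_fin mulr_ge0// mulr_ge0.
  - by apply: measurable_funeM; exact: m.
  rewrite ge0_integralD//; last 4 first.
  - by move=> x _; rewrite -!EFinM lee_fin mulr_ge0.
  - by apply: measurable_funeM; exact: m.
  - by move=> x _; rewrite -!EFinM lee_fin mulr_ge0.
  - by apply: measurable_funeM; exact: m.
  rewrite !ge0_integralZl_EFin// ?J1 ?J2 ?J3//;
    do ?[exact: m|by move=> x _; rewrite lee_fin|by rewrite mulr_ge0].
under eq_eseriesr do rewrite JF.
have /andP[r10 r11] := rho_bound u1 hp1.
have /andP[r20 r21] := rho_bound u2 hp2.
have ple1 : p1 * p2 * q <= 1.
  by case/andP: hp1 hp2 hq => ? ? /andP[? ?] /andP[? ?]; rewrite !mulr_ile1// ?mulr_ge0 ?ltW.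
have t1 n : (0 <= (p1 * p2 * q * z1 * rho1 ^+ n)%:E)%E.
  by rewrite lee_fin; apply: mulr_ge0; [apply: mulr_ge0; exact: ltW|exact: exprn_ge0].
have t2 n : (0 <= (p1 * p2 * q * z2 * rho2 ^+ n)%:E)%E.
  by rewrite lee_fin; apply: mulr_ge0; [apply: mulr_ge0; exact: ltW|exact: exprn_ge0].
have t3 n : (0 <= ((1 - p1 * p2 * q) ^+ n)%:E)%E.
  by rewrite lee_fin exprn_ge0// subr_ge0.
have K0' : (0 <= K%:E)%E by rewrite lee_fin ltW.
have Kp0 : (0 <= (K * (p1 * p2 * q))%:E)%E by rewrite lee_fin; apply: mulr_ge0; exact: ltW.
rewrite nneseriesD; last 2 first.
- by move=> i _ _; rewrite adde_ge0// mule_ge0.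
- by move=> i _ _; rewrite mule_ge0.
rewrite nneseriesD; last 2 first.
- by move=> i _ _; rewrite mule_ge0.
- by move=> i _ _; rewrite mule_ge0.
rewrite !nneseriesZl//.
(* Each of the two rank series contributes 3/2 K, and the series of the [h3] products contributes
   K. *)
have -> : 4 * K = K * (3 / 2) + K * (3 / 2) + (K * (p1 * p2 * q)) * (p1 * p2 * q)^-1.
  by field; rewrite gt_eqF//; case/andP: hp1 hp2 hq => ? _ /andP[? _] /andP[? _];
    rewrite ?gt_eqF.
rewrite !EFinD.
apply: leeD; first apply: leeD.
- rewrite [leRHS]EFinM; apply: lee_wpmul2l => //.
  by apply: geometric_part => //; ring.
- rewrite [leRHS]EFinM; apply: lee_wpmul2l => //.
  by apply: geometric_part => //; ring.
- rewrite [leRHS]EFinM; apply: lee_wpmul2l => //.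
  rewrite -[in leRHS](subKr 1 (p1 * p2 * q)); apply: geometric_nneseries_le.
  by rewrite subr_ge0 ple1 ltrBlDr ltrDl.
Qed.

End upper_bound.

(** * Lower bound for given environments *)

Section one_minus_pos.
Context (R : realType).
Local Open Scope ereal_scope.

(* The positive part of 1 - x: integrating it avoids subtracting integrals. *)
Definition one_minus_pos (x : \bar R) : \bar R := maxe 0 (1 - x).

Lemma one_minus_pos_ge0 x : 0 <= one_minus_pos x.
Proof. by rewrite /one_minus_pos le_max lexx. Qed.

(** With [one_le_one_minus_pos] it characterizes [one_minus_pos x] as the least nonnegative y with 1
    <= y + x, the form that gives monotonicity and Jensen's inequality below. *)
Lemma one_minus_pos_le x y : 0 <= x -> 0 <= y -> 1 <= y + x -> one_minus_pos x <= y.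
Proof.
rewrite /one_minus_pos; case: x => [x| |]; case: y => [y| |] //= x0 y0.
- rewrite -EFinD -EFinB lee_fin => h; rewrite ge_max y0 lee_fin.
  by rewrite lerBlDr.
- by move=> _; rewrite leey.
Qed.

Lemma one_le_one_minus_pos x : 0 <= x -> 1 <= one_minus_pos x + x.
Proof.
rewrite /one_minus_pos; case: x => [x| |] //= x0; last by rewrite addey ?leey.
rewrite -EFinB -EFin_max -EFinD lee_fin -lerBlDr.
by rewrite le_max lexx orbT.
Qed.

Lemma measurable_one_minus_pos d (T : measurableType d) (f : T -> \bar R) :
  measurable_fun setT f -> measurable_fun setT (one_minus_pos \o f).
Proof.
move=> mf; apply: measurable_maxe; first exact: measurable_cst.
by apply: emeasurable_funB; first exact: measurable_cst.
Qed.

(** Jensen's inequality for the convex positive part of 1 - x, obtained by integrating the pointwise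
    bound 1 <= (1 - f)^+ + f. *)
Lemma le_integral_one_minus_pos d (T : measurableType d)
    (P : {measure set T -> \bar R}) (f : T -> \bar R) : P setT = 1 ->
  measurable_fun setT f -> (forall x, 0 <= f x) ->
  one_minus_pos (\int[P]_x f x) <= \int[P]_x one_minus_pos (f x).
Proof.
move=> P1 mf f0; apply: one_minus_pos_le.
- exact: integral_ge0.
- by apply: integral_ge0 => x _; exact: one_minus_pos_ge0.
- rewrite -ge0_integralD//; last 2 first.
  + by move=> x _; exact: one_minus_pos_ge0.
  + exact: measurable_one_minus_pos.
  rewrite [leLHS](_ : _ = \int[P]_x (cst 1 x)); last by rewrite integral_cst// mul1e.
  apply: le_integral_nonneg => x; first exact: lee01.
  exact: one_le_one_minus_pos.
Qed.

Lemma one_minus_pos_anti x y : 0 <= x -> x <= y -> one_minus_pos y <= one_minus_pos x.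
Proof.
move=> x0 xy; apply: one_minus_pos_le => //; first exact: le_trans xy.
  exact: one_minus_pos_ge0.
apply: le_trans (one_le_one_minus_pos x0) _; exact: leeD.
Qed.

End one_minus_pos.

Lemma integral_coord_nat (R : realType) (P : {measure set selections -> \bar R})
    (t : nat) (g : nat -> \bar R) : (forall j, 0 <= g j)%E ->
  (\int[P]_a g (a t) = \sum_(j <oo) g j * P [set a | a t = j])%E.
Proof.
move=> g0.
have gE (a : selections) : g (a t) = (\sum_(j <oo) g j * (\1_[set j] (a t))%:E)%E.
  rewrite (@nneseries_single _ _ (a t)).
  - by rewrite indicE mem_set// mule1.
  - by rewrite mule_ge0// lee_fin.
  - by move=> i it; rewrite indicE memNset ?mule0// => /= e; rewrite e eqxx in it.
under eq_integral do rewrite gE.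
have m j : measurable_fun setT (fun a : selections => (\1_[set j] (a t))%:E : \bar R).
  by apply/measurable_EFinP;
    exact: (@measurable_coord _ nat (fun=> I) t _ _ (fun i => \1_[set j] i : R)).
rewrite integral_nneseries//; last 2 first.
- by move=> j; apply: measurable_funeM; exact: m.
- by move=> j a _; rewrite mule_ge0// lee_fin.
apply: eq_eseriesr => j _; rewrite ge0_integralZl//.
by congr (_ * _)%E; exact: (@integral_coord_indic _ nat _ (fun=> I)).
Qed.

Lemma sum_coord_nat (R : realType) (P : {measure set selections -> \bar R}) (t : nat) :
  P setT = 1%E -> (\sum_(j <oo) P [set a | a t = j] = 1)%E.
Proof.
move=> P1; have := @integral_coord_nat R P t (fun=> 1%E) (fun=> lee01).
rewrite integral_cst// P1 mule1 => ->.
by apply: eq_eseriesr => j _; rewrite mul1e.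
Qed.

Section conditional_lower_bound.
Context (R : realType) (A B E : env) (s n : nat).
Variables (mu nu : {measure set selections -> \bar R}).
Hypotheses (mu1 : mu setT = 1%E) (nu1 : nu setT = 1%E).
Variables (x y : nat -> \bar R).
Hypothesis mux : forall (t j : nat), mu [set a | a t = j] = x j.
Hypothesis nuy : forall (t j : nat), nu [set b | b t = j] = y j.

(** The chance that Bob turns a selection j of Alice into a success. It is the same in every slot,
    which is how the offset s disappears. *)
Let g (j : nat) : \bar R := ([&& A j, B j & E j]%:R%:E * y j)%E.

Let y0 j : (0 <= y j)%E. Proof. by rewrite -(nuy 0%N j). Qed.
Let x0 j : (0 <= x j)%E. Proof. by rewrite -(mux 0%N j). Qed.

Let g0 j : (0 <= g j)%E.
Proof. by apply: mule_ge0; rewrite // lee_fin ler0n. Qed.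

Let hit (a : selections) (t : nat) : set selections :=
  [set b | [&& A (a t), B (a t) & E (a t)] /\ b (s + t)%N = a t].

Let mhit a t : measurable (hit a t).
Proof.
exact: (@measurable_coord_set _ nat (fun=> I) (s + t)
  [set j | [&& A (a t), B (a t) & E (a t)] /\ j = a t]).
Qed.

Let nu_hit a t : nu (hit a t) = g (a t).
Proof.
rewrite /hit /g; case: [&& _, _ & _]; last first.
  rewrite mul0e -[RHS](measure0 nu); congr (nu _).
  by apply/seteqP; split => b // [].
rewrite mul1e -(nuy (s + t)%N); congr (nu _).
by apply/seteqP; split => b //= [].
Qed.

Let sync_ge a b : (forall t, (t < n)%N -> ~ hit a t b) ->
  (n.+1%:R%:E <= sync_time R A B E s a b)%E.
Proof.
move=> nh; apply: le_ereal_inf_tmp => _ [t [ab [At Bt Et]] <-].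
rewrite lee_fin ler_nat ltnS leqNgt; apply/negP => /nh; apply; split => //.
by rewrite At Bt Et.
Qed.

Let inner (a : selections) : (n.+1%:R%:E * one_minus_pos (\sum_(t < n) g (a t)) <=
  \int[nu]_b sync_time R A B E s a b)%E.
Proof.
pose N := ~` (\big[setU/set0]_(t < n) hit a t).
have mU : measurable (\big[setU/set0]_(t < n) hit a t).
  by apply: bigsetU_measurable => t _; exact: mhit.
have mN : measurable N by exact: measurableC.
(* The union bound in additive form; it bounds [nu N] by a positive part even when the sum exceeds
   1. *)
have Nle : (1 <= nu N + \sum_(t < n) g (a t))%E.
  apply: (@le_trans _ _ (nu N + nu (\big[setU/set0]_(t < n) hit a t))%E); last first.
    apply: leeD => //.
    rewrite [leRHS](eq_bigr (fun t : 'I_n => nu (hit a t))); last by move=> t _; rewrite nu_hit.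
    by apply: (@Boole_inequality _ _ _ nu (hit a)) => t _; exact: mhit.
  have e : nu (N `|` (\big[setU/set0]_(t < n) hit a t)) = 1%E.
    by rewrite -nu1; congr (nu _); exact: setvU.
  by rewrite -e; exact: measureU2.
apply: (@le_trans _ _ (n.+1%:R%:E * nu N)%E).
  apply: lee_wpmul2l; first by rewrite lee_fin.
  by apply: one_minus_pos_le => //; exact: sume_ge0.
rewrite -[nu N]mul1e -(setIT N) -integral_indic// mul1e -ge0_integralZl//;
  last by apply/measurable_EFinP; exact: measurable_indic.
apply: le_integral_nonneg => b; first by rewrite mule_ge0// lee_fin.
rewrite indicE; have [/set_mem Nb|_] := boolP (b \in N); last first.
  rewrite mule0; apply: le_ereal_inf_tmp => _ [t _ <-]; by rewrite lee_fin.
rewrite mule1; apply: sync_ge => t tn hb; apply: Nb.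
by rewrite -bigcup_mkord; exists t.
Qed.

(** Jensen moves Alice's integral inside the positive part, where only the laws of single selections
    remain. *)
Lemma conditional_sync_time_ge :
  (n.+1%:R%:E * one_minus_pos (\sum_(t < n)
     \sum_(j <oo) [&& A j, B j & E j]%:R%:E * y j * x j) <=
   \int[mu]_a \int[nu]_b sync_time R A B E s a b)%E.
Proof.
have mg t : measurable_fun setT (fun a : selections => g (a t)).
  exact: (@measurable_coord _ nat (fun=> I) t _ _ g).
have msum : measurable_fun setT (fun a : selections => \sum_(t < n) g (a t))%E.
  by apply: emeasurable_sum => t _; exact: mg.
apply: (@le_trans _ _
  (\int[mu]_a (n.+1%:R%:E * one_minus_pos (\sum_(t < n) g (a t))))%E); last first.
  apply: le_integral_nonneg => a; last exact: inner.
  by rewrite mule_ge0 ?one_minus_pos_ge0// lee_fin.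
rewrite ge0_integralZl//; last 2 first.
- exact: (measurable_one_minus_pos msum).
- by move=> a _; exact: one_minus_pos_ge0.
apply: lee_wpmul2l; first by rewrite lee_fin.
apply: (le_trans _ (le_integral_one_minus_pos mu1 msum _)); last first.
  by move=> a; exact: sume_ge0.
rewrite ge0_integral_sum//.
rewrite le_eqVlt; apply/orP; left; apply/eqP; congr one_minus_pos.
apply: eq_bigr => t _; rewrite integral_coord_nat//.
by apply: eq_eseriesr => j _; rewrite mux.
Qed.

End conditional_lower_bound.

(** * Heavy and light channels: lower bound for stationary strategies *)

Section lower_bound.
Context (R : realType) (p1 p2 q : R) (PA PB PE : probability env R) (ka kb : strategy R).
Hypotheses (hp1 : 0 < p1 <= 1) (hp2 : 0 < p2 <= 1) (hq : 0 < q <= 1).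
Hypotheses (bA : bernoulli_env p1 PA) (bB : bernoulli_env p2 PB).
Hypothesis (bE : bernoulli_env q PE).
Hypotheses (ska : stationary ka) (skb : stationary kb).

Lemma integral_prod_env_mul (f g h : env -> \bar R) :
  measurable_fun setT f -> measurable_fun setT g -> measurable_fun setT h ->
  (forall x, 0 <= f x)%E -> (forall x, 0 <= g x)%E -> (forall x, 0 <= h x)%E ->
  measurable_fun setT (fun x : env * (env * env) => f x.1 * (g x.2.1 * h x.2.2))%E /\
  (\int[prod_env PA PB PE]_x (f x.1 * (g x.2.1 * h x.2.2)) =
   \int[PA]_x f x * (\int[PB]_x g x * \int[PE]_x h x))%E.
Proof.
move=> mf mg mh f0 g0 h0.
have m : measurable_fun setT (fun x : env * (env * env) => f x.1 * (g x.2.1 * h x.2.2))%E.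
  apply: emeasurable_funM; first exact: (measurableT_comp mf
    (@measurable_fst _ _ env (env * env)%type)).
  apply: emeasurable_funM.
    exact: (measurableT_comp mg (measurableT_comp (@measurable_fst _ _ env env)
      (@measurable_snd _ _ env (env * env)%type))).
  exact: (measurableT_comp mh (measurableT_comp (@measurable_snd _ _ env env)
      (@measurable_snd _ _ env (env * env)%type))).
split => //; rewrite -integral_prod_measure3//; last first.
  by move=> x; rewrite !mule_ge0.
have gh0 : (0 <= \int[PB]_x g x)%E by exact: integral_ge0.
have hh0 : (0 <= \int[PE]_x h x)%E by exact: integral_ge0.
under eq_integral => A _.
  under eq_integral => B _.
    rewrite /= ge0_integralZl//; last 2 first.
    - exact: measurable_funeM.
    - by move=> E _; rewrite mule_ge0.
    rewrite ge0_integralZl//.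
    over.
  rewrite /= ge0_integralZl//; last 2 first.
  - by apply: emeasurable_funM => //; exact: measurable_cst.
  - by move=> B _; rewrite mule_ge0.
  rewrite ge0_integralZr//.
  over.
by rewrite /= ge0_integralZr// mule_ge0.
Qed.

Let fA (j : nat) (A : env) : \bar R := (slot_law ka 0 A [set j] * (A j)%:R%:E)%E.
Let fB (j : nat) (B : env) : \bar R := (slot_law kb 0 B [set j] * (B j)%:R%:E)%E.

Let mbit (j : nat) : measurable_fun setT (fun A : env => (A j)%:R%:E : \bar R).
Proof.
by apply/measurable_EFinP;
    exact: (@measurable_coord _ bool (fun=> I) j _ _ (fun b : bool => b%:R : R)).
Qed.

Let mslot (k : strategy R) (j : nat) : measurable_fun setT (fun A => slot_law k 0 A [set j]).
Proof.
apply: measurable_kernel.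
exact: (@measurable_coord_set _ nat (fun=> I) 0 [set j]).
Qed.

Let slot_ge0 (k : strategy R) A j : (0 <= slot_law k 0 A [set j])%E.
Proof. exact: measure_ge0. Qed.

Let bit_ge0 (b : bool) : (0 <= b%:R%:E :> \bar R)%E.
Proof. by rewrite lee_fin ler0n. Qed.

(** Averaging over the local environment makes this number deterministic, so [heavy] is a fixed set
    of channels. The same formula serves both parties. *)
Let weight (k : strategy R) (P : probability env R) (j : nat) : \bar R :=
  (\int[P]_A (slot_law k 0 A [set j] * (A j)%:R%:E))%E.

Let weight_ge0 k P j : (0 <= weight k P j)%E.
Proof. by apply: integral_ge0 => A _; rewrite mule_ge0. Qed.

Let sum_weight k P : (\sum_(j <oo) weight k P j <= 1)%E.
Proof.
rewrite -integral_nneseries//; last 2 first.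
- by move=> j; apply: emeasurable_funM.
- by move=> j A _; rewrite mule_ge0.
apply: (@le_trans _ _ (\int[P]_A (cst 1 A)))%E; last first.
  by rewrite integral_cst// mul1e probability_le1.
apply: le_integral_nonneg => A; first by apply: nneseries_ge0 => j _ _; rewrite mule_ge0.
rewrite /= -(@sum_coord_nat R (k A) 0); last exact: prob_kernel.
apply: lee_nneseries => j _; first by rewrite mule_ge0.
rewrite -[leRHS]mule1; apply: lee_wpmul2l => //.
by rewrite lee_fin; case: (A j).
Qed.

Let p := p1 * p2 * q.
Let p0 : 0 < p.
Proof.
by case/andP: hp1 hp2 hq => ? _ /andP[? _] /andP[? _]; rewrite !mulr_gt0.
Qed.
Let q0 : 0 < q. Proof. by case/andP: hq. Qed.
Let pq0 : (0 <= (4 * p * q)%:E)%E.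
Proof. by rewrite lee_fin; apply: mulr_ge0; [apply: mulr_ge0|]; rewrite // ltW. Qed.

Let heavy (j : nat) : bool := ((4 * p)%:E < weight ka PA j)%E.

Let bit_mean (r : R) (P : probability env R) j : bernoulli_env r P ->
  (\int[P]_A (A j)%:R%:E = r%:E)%E.
Proof.
move=> bP; rewrite (integral_bernoulli j (f := fun b : bool => b%:R) bP)//.
by rewrite /avg mulr1 mulr0 addr0.
Qed.

(** The sum [beta] counts the good heavy channels; its mean bounds the probability that there is
    one. *)
Let beta_term (j : nat) (x : env * (env * env)) : \bar R :=
  ((heavy j)%:R%:E * ((x.1 j)%:R%:E * ((x.2.1 j)%:R%:E * (x.2.2 j)%:R%:E)))%E.

(** The sum [sigma] is the conditional probability of a success on a light channel in one slot. *)
Let sigma_term (j : nat) (x : env * (env * env)) : \bar R :=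
  ((~~ heavy j)%:R%:E * (fA j x.1 * (fB j x.2.1 * (x.2.2 j)%:R%:E)))%E.

Let beta x : \bar R := (\sum_(j <oo) beta_term j x)%E.
Let sigma x : \bar R := (\sum_(j <oo) sigma_term j x)%E.

Let mfA (k : strategy R) j : measurable_fun setT (fun A => slot_law k 0 A [set j] * (A j)%:R%:E)%E.
Proof. exact: emeasurable_funM. Qed.

Let fA_ge0 (k : strategy R) j A : (0 <= slot_law k 0 A [set j] * (A j)%:R%:E)%E.
Proof. exact: mule_ge0. Qed.

Let beta_term_ge0 j x : (0 <= beta_term j x)%E.
Proof. by rewrite /beta_term !mule_ge0. Qed.
Let sigma_term_ge0 j x : (0 <= sigma_term j x)%E.
Proof. by rewrite /sigma_term mule_ge0// mule_ge0 ?fA_ge0// mule_ge0 ?fA_ge0. Qed.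
Let mbeta_term j : measurable_fun setT (beta_term j).
Proof.
apply: measurable_funeM.
by have [] := integral_prod_env_mul (mbit j) (mbit j) (mbit j)
  (fun A => bit_ge0 (A j)) (fun A => bit_ge0 (A j)) (fun A => bit_ge0 (A j)).
Qed.
Let msigma_term j : measurable_fun setT (sigma_term j).
Proof.
apply: measurable_funeM.
by have [] := integral_prod_env_mul (mfA ka j) (mfA kb j) (mbit j)
  (fA_ge0 ka j) (fA_ge0 kb j) (fun A => bit_ge0 (A j)).
Qed.
Let beta_ge0 x : (0 <= beta x)%E. Proof. exact: nneseries_ge0. Qed.
Let sigma_ge0 x : (0 <= sigma x)%E. Proof. exact: nneseries_ge0. Qed.
Let mbeta : measurable_fun setT beta.
Proof. exact: ge0_emeasurable_sum. Qed.
Let msigma : measurable_fun setT sigma.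
Proof. exact: ge0_emeasurable_sum. Qed.

(** A heavy channel contributes p, which is less than a quarter of its weight, and the weights sum
    to at most 1. *)
Let integral_beta : (\int[prod_env PA PB PE]_x beta x <= (4^-1)%:E)%E.
Proof.
rewrite integral_nneseries//.
apply: (@le_trans _ _ (\sum_(j <oo) ((4^-1)%:E * weight ka PA j))%E); last first.
  rewrite nneseriesZl// -[leRHS]mule1; exact: lee_wpmul2l.
apply: lee_nneseries => j _; first by move=> _; exact: integral_ge0.
rewrite ge0_integralZl//; do ?[by move=> x _; rewrite !mule_ge0|
  by have [] := integral_prod_env_mul (mbit j) (mbit j) (mbit j)
    (fun A => bit_ge0 (A j)) (fun A => bit_ge0 (A j)) (fun A => bit_ge0 (A j))].
have [_ ->] := integral_prod_env_mul (mbit j) (mbit j) (mbit j)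
  (fun A => bit_ge0 (A j)) (fun A => bit_ge0 (A j)) (fun A => bit_ge0 (A j)).
rewrite (bit_mean j bA) (bit_mean j bB) (bit_mean j bE) -!EFinM.
rewrite /heavy; case: ltP => [h|_]; last by rewrite mul0r mule_ge0// lee_fin invr_ge0.
apply: (@le_trans _ _ ((4^-1)%:E * (4 * p)%:E)%E).
  by rewrite -EFinM lee_fin mul1r /p !mulrA mulVf// mul1r.
by apply: lee_wpmul2l; [rewrite lee_fin invr_ge0|exact: ltW].
Qed.

(** A light channel contributes q times both weights; Alice's is at most 4 p, and Bob's sum to at
    most 1. *)
Let integral_sigma : (\int[prod_env PA PB PE]_x sigma x <= (4 * p * q)%:E)%E.
Proof.
rewrite integral_nneseries//.
apply: (@le_trans _ _ (\sum_(j <oo) ((4 * p * q)%:E * weight kb PB j))%E); last first.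
  rewrite nneseriesZl// -[leRHS]mule1; exact: lee_wpmul2l.
apply: lee_nneseries => j _; first by move=> _; exact: integral_ge0.
rewrite ge0_integralZl//; last 2 first.
- by have [] := integral_prod_env_mul (mfA ka j) (mfA kb j) (mbit j)
    (fA_ge0 ka j) (fA_ge0 kb j) (fun A => bit_ge0 (A j)).
- by move=> x _; rewrite mule_ge0 ?fA_ge0// mule_ge0 ?fA_ge0.
have [_ ->] := integral_prod_env_mul (mfA ka j) (mfA kb j) (mbit j)
    (fA_ge0 ka j) (fA_ge0 kb j) (fun A => bit_ge0 (A j)).
rewrite (bit_mean j bE) -/(weight ka PA j) -/(weight kb PB j).
rewrite /heavy; case: ltP => [_|h]; first by rewrite mul0e mule_ge0.
rewrite mul1e (muleC (weight kb PB j)) EFinM -muleA.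
by apply: lee_wpmul2r => //; apply: mule_ge0 => //; rewrite lee_fin ltW.
Qed.

(** A good heavy channel makes [beta] at least 1 and the left side 0. Otherwise [sigma] is the whole
    success probability of a slot. *)
Let conditional_ge s n A B E :
  (n.+1%:R%:E * one_minus_pos (beta (A, (B, E)) + \sum_(t < n) sigma (A, (B, E))) <=
   \int[ka A]_a \int[kb B]_b sync_time R A B E s a b)%E.
Proof.
have X0 : (0 <= \int[ka A]_a \int[kb B]_b sync_time R A B E s a b)%E.
  apply: integral_ge0 => a _; apply: integral_ge0 => b _.
  by apply: le_ereal_inf_tmp => _ [t _ <-]; rewrite lee_fin.
have ss0 : (0 <= \sum_(t < n) sigma (A, (B, E)))%E by exact: sume_ge0.
have [[j [hj Gj]]|H] := pselect (exists j, heavy j /\ [&& A j, B j & E j]).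
  rewrite (_ : one_minus_pos _ = 0%E) ?mule0//.
  apply/eqP; rewrite eq_le one_minus_pos_ge0 andbT.
  apply: one_minus_pos_le => //; first by rewrite adde_ge0.
  rewrite add0e; apply: (le_trans _ (leeDl _ ss0)).
  apply: (@le_trans _ _ (beta_term j (A, (B, E)))).
    by rewrite /beta_term hj; case/and3P: Gj => /= -> -> ->; rewrite !mule1.
  apply: (le_trans _ (nneseries_lim_ge j.+1 _)) => //.
  by rewrite big_nat_recr//= leeDr// sume_ge0.
apply: (le_trans _ (@conditional_sync_time_ge R A B E s n (ka A) (kb B)
  (prob_kernel A) (prob_kernel B) (fun j => slot_law ka 0 A [set j])
  (fun j => slot_law kb 0 B [set j]) _ _)); last 2 first.
- by move=> t j; exact: slot_law_stationary.
- by move=> t j; exact: slot_law_stationary.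
apply: lee_wpmul2l; first by rewrite lee_fin.
apply: one_minus_pos_anti.
  by apply: sume_ge0 => t _; apply: nneseries_ge0 => j _ _; rewrite !mule_ge0.
apply: (le_trans _ (leeDr _ (beta_ge0 _))).
apply: lee_sum => t _; apply: lee_nneseries => j _; first by rewrite !mule_ge0.
have [G|nG] := boolP [&& A j, B j & E j]; last by rewrite !mul0e.
rewrite /sigma_term; have -> : heavy j = false by apply/negP => hj; apply: H; exists j.
by case/and3P: G => /= Aj Bj Ej; rewrite /fA /fB /= Aj Bj Ej !mule1 !mul1e muleC.
Qed.

Lemma expected_sync_time_ge s :
  ((32^-1 / (p1 * p2 * q ^+ 2))%:E <= expected_sync_time PA PB PE ka kb s)%E.
Proof.
have pq1 : 0 < p * q by exact: mulr_gt0.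
(* The largest n with n * 4 p q <= 1/4. Together with the 1/4 from [beta] this leaves probability
   1/2, and (n + 1) / 2 > 1 / (32 p q) yields the constant. *)
pose n := Num.truncn (16 * (p * q))^-1.
have y0 : 0 <= (16 * (p * q))^-1 by rewrite invr_ge0; apply: mulr_ge0; rewrite // ltW.
have nle : n%:R <= (16 * (p * q))^-1 by rewrite truncn_le.
have ltn : (16 * (p * q))^-1 < n.+1%:R by exact: truncnS_gt.
pose S x := (beta x + \sum_(t < n) sigma x)%E.
have S0 x : (0 <= S x)%E by rewrite adde_ge0// sume_ge0.
have msums : measurable_fun setT (fun x => \sum_(t < n) sigma x)%E.
  by apply: emeasurable_sum => t _; exact: msigma.
have mS : measurable_fun setT S by exact: emeasurable_funD.
(* [prod_env] is typed as a subprobability; its total mass is read off from the empty product. *)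
have P1 : prod_env PA PB PE setT = 1%E.
  have := integral_prod3 hp1 hp2 hq bA bB bE (h := fun _ _ _ _ => 1) 0 (fun _ _ _ _ => ler01).
  rewrite big_ord0 (eq_integral (cst 1%E)); last by move=> x _; rewrite /prod3 big_ord0.
  by rewrite integral_cst// mul1e.
have half : ((2^-1)%:E <= \int[prod_env PA PB PE]_x one_minus_pos (S x))%E.
  apply: (le_trans _ (le_integral_one_minus_pos P1 mS S0)).
  apply: (@le_trans _ _ (one_minus_pos (2^-1)%:E)).
    by rewrite /one_minus_pos -EFinB le_max; apply/orP; right; rewrite lee_fin; lra.
  apply: one_minus_pos_anti; first exact: integral_ge0.
  rewrite ge0_integralD//; last by move=> x _; exact: sume_ge0.
  rewrite ge0_integral_sum//.
  apply: (@le_trans _ _ ((4^-1)%:E + \sum_(t < n) (4 * p * q)%:E)%E).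
    by apply: leeD => //; apply: lee_sum.
  rewrite sumEFin -EFinD lee_fin sumr_const card_ord -[_ *+ n]mulr_natr.
  have : 4 * p * q * n%:R <= 4 * p * q * (16 * (p * q))^-1.
    by apply: ler_wpM2l.
  have -> : 4 * p * q * (16 * (p * q))^-1 = 4^-1.
    by field; rewrite !gt_eqF.
  by lra.
apply: (@le_trans _ _ (n.+1%:R%:E * (2^-1)%:E)%E).
  rewrite -EFinM lee_fin (_ : _ / _ = (16 * (p * q))^-1 / 2).
    by rewrite ler_pM2r// ltW.
  rewrite /p; field; case/andP: hp1 hp2 hq => ? _ /andP[? _] /andP[? _].
  by rewrite !gt_eqF.
apply: (@le_trans _ _ (n.+1%:R%:E * \int[prod_env PA PB PE]_x one_minus_pos (S x))%E).
  by apply: lee_wpmul2l => //; rewrite lee_fin.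
have mm : measurable_fun setT (fun x => one_minus_pos (S x)) by exact: measurable_one_minus_pos.
rewrite -ge0_integralZl//; last by move=> x _; exact: one_minus_pos_ge0.
rewrite -integral_prod_measure3; last 2 first.
- exact: measurable_funeM.
- by move=> x; rewrite mule_ge0 ?one_minus_pos_ge0// lee_fin.
have h0 A B E : (0 <= n.+1%:R%:E * one_minus_pos (S (A, (B, E))))%E.
  by rewrite mule_ge0 ?one_minus_pos_ge0// lee_fin.
apply: le_integral_nonneg => A; first by do 2 (apply: integral_ge0 => ? _).
apply: le_integral_nonneg => B; first by apply: integral_ge0.
by apply: le_integral_nonneg => // E; exact: conditional_ge.
Qed.

End lower_bound.

(** * Independent sampling from a given law on the naturals *)

(** The rescaled image measure agrees with Lebesgue measure on half-open intervals, which determine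
    it. *)
Lemma lebesgue_measure_affine (R : realType) (c r : R) (W : set (measurableTypeR R)) :
  0 < r -> measurable W ->
  lebesgue_measure [set x : measurableTypeR R | W ((x - c) / r)] =
  (r%:E * lebesgue_measure W)%E.
Proof.
move=> r0 mW; pose f (x : measurableTypeR R) : measurableTypeR R := (x - c) / r.
have mf : measurable_fun setT f.
  by apply: measurable_funM => //; apply: measurable_funB.
have s0 : 0 <= r^-1 by rewrite invr_ge0 ltW.
have H : lebesgue_measure W = mscale (NngNum s0) (pushforward lebesgue_measure f) W.
  move=> m; apply: lebesgue_measure_unique => //= _ [[a b] _ <-].
  rewrite /mscale/= /pushforward.
  rewrite (_ : f @^-1` _ = `]a * r + c, b * r + c]%classic); last first.
    apply/seteqP; split => x /=; rewrite /f !in_itv/= ltr_pdivlMr// ler_pdivrMr//.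
      by case/andP => ? ?; apply/andP; split; lra.
    by case/andP => ? ?; apply/andP; split; lra.
  rewrite !lebesgue_measure_itv/= !lte_fin ltrD2r ltr_pM2r//.
  case: ifP => _; last by rewrite mule0.
  by rewrite -!EFinB -EFinM; congr EFin; field; rewrite gt_eqF.
by rewrite (H mf) /mscale/= muleA -EFinM mulfV ?gt_eqF// mul1e.
Qed.

(** The constant c accommodates functions defined by [xget], which take a default value off all the
    pieces. *)
Lemma measurable_piecewise d d' (X : measurableType d) (Y : measurableType d')
    (I_ : nat -> set X) (g : nat -> X -> Y) (c : Y) (f : X -> Y) :
  (forall j, measurable (I_ j)) -> (forall j, measurable_fun setT (g j)) ->
  (forall j x, I_ j x -> f x = g j x) ->
  (forall x, (forall j, ~ I_ j x) -> f x = c) ->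
  measurable_fun setT f.
Proof.
move=> mI mg fg fc _ V mV; rewrite setTI.
rewrite (_ : f @^-1` V = (\bigcup_j (I_ j `&` g j @^-1` V)) `|`
    (~` (\bigcup_j I_ j) `&` (cst c @^-1` V))).
  apply: measurableU.
    apply: bigcupT_measurable => j; apply: measurableI => //.
    by rewrite -[X in measurable X]setTI; exact: mg.
  apply: measurableI; first by apply: measurableC; exact: bigcupT_measurable.
  by rewrite -[X in measurable X]setTI; exact: measurable_cst.
apply/seteqP; split => x /=.
  move=> Vx; have [[j Ij]|nI] := pselect (exists j, I_ j x).
    by left; exists j => //; split => //=; rewrite -fg.
  right; split; first by case=> j _ Ij; apply: nI; exists j.
  by rewrite /= -(fc x)// => j Ij; apply: nI; exists j.
case=> [[j _ [Ij /=]]|[nI /=]]; first by rewrite (fg j).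
by rewrite (fc x)// => j Ij; apply: nI; exists j.
Qed.

Lemma measurable_seq_space d d' (X : measurableType d) (T : measurableType d')
    (f : X -> seq_space T) : (forall t, measurable_fun setT (fun x => f x t)) ->
  measurable_fun setT f.
Proof.
move=> mf; have G : preimage_set_system setT f (cylinders T) `<=` measurable.
  move=> _ [_ [t _ [U mU <-]] <-]; rewrite !setTI.
  by have := mf t measurableT U mU; rewrite setTI.
exact: (@measurability _ _ X (seq_space T) setT f (cylinders T) erefl G).
Qed.

Section independent_sampling.
Context (R : realType) (v : nat -> R).
Hypotheses (v0 : forall j, 0 <= v j) (v1 : (\sum_(j <oo) (v j)%:E = 1)%E).
Let T := measurableTypeR R.
Let F (j : nat) : R := \sum_(i < j) v i.

Let FS j : F j.+1 = F j + v j.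
Proof. by rewrite /F big_ord_recr. Qed.

Let Fle i j : (i <= j)%N -> F i <= F j.
Proof.
move/subnK <-; elim: (j - i)%N => [|k IH]; first by rewrite add0n.
by rewrite addSn FS (le_trans IH)// lerDl.
Qed.

Let F_ge0 j : 0 <= F j.
Proof. by apply: sumr_ge0. Qed.

Let F_le1 j : F j <= 1.
Proof.
rewrite -lee_fin -v1 /F -sumEFin -(big_mkord xpredT (fun i => (v i)%:E)).
by apply: nneseries_lim_ge => i _ _; rewrite lee_fin.
Qed.

Let F_sup x : x < 1 -> exists j, x < F j.
Proof.
move=> x1; apply: contrapT => H.
have : (\sum_(j <oo) (v j)%:E <= x%:E)%E.
  apply: lime_le; first by apply: is_cvg_nneseries => n _ _; rewrite lee_fin.
  apply: nearW => n; rewrite sumEFin lee_fin big_mkord leNgt; apply/negP => xF.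
  by apply: H; exists n.
by rewrite v1 lee_fin leNgt x1.
Qed.

Let cell (j : nat) : set T := [set x | F j <= x < F j.+1].

Let cell_uniq x i j : cell i x -> cell j x -> i = j.
Proof.
move=> /andP[ix xi] /andP[jx xj]; apply/eqP; rewrite eqn_leq.
apply/andP; split; rewrite leqNgt; apply/negP => /Fle ij.
  by have := lt_le_trans xj (le_trans ij ix); rewrite ltxx.
by have := lt_le_trans xi (le_trans ij jx); rewrite ltxx.
Qed.

Let cell_cover x : 0 <= x < 1 -> exists j, cell j x.
Proof.
case/andP => x0 /F_sup H; case: (ex_minnP H) => -[|j] xF jmin.
  by move: xF; rewrite /F big_ord0 ltNge x0.
exists j; rewrite /cell /= xF andbT leNgt; apply/negP => /jmin.
by rewrite ltnn.
Qed.

Let cell01 j x : cell j x -> 0 <= x < 1.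
Proof.
by case/andP => jx xj; rewrite (le_trans (F_ge0 j) jx) (lt_le_trans xj (F_le1 _)).
Qed.

Let mcell j : measurable (cell j).
Proof.
rewrite (_ : cell j = `[F j, F j.+1[%classic); first exact: measurable_itv.
by apply/seteqP; split => x /=; rewrite /cell/= in_itv.
Qed.

(* [0, 1[ is cut into consecutive cells of lengths v 0, v 1, and so on; digit
   tells the cell of x and shift stretches this cell onto [0, 1[. Under Lebesgue
   measure digit x has law v and is independent of shift x, which is uniform, so
   the digits of the iterates of shift are independent with law v. *)
Let digit (x : T) : nat := xget 0%N [set j | cell j x].

Let digitE j x : cell j x -> digit x = j.
Proof. by move=> cj; apply: xget_unique => // i ci; exact: cell_uniq ci cj. Qed.

Let digit0 x : (forall j, ~ cell j x) -> digit x = 0%N.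
Proof. by move=> H; exact: xgetPN. Qed.

Let rescale (j : nat) (x : T) : T := (x - F j) / v j.

Let mrescale j : measurable_fun setT (rescale j).
Proof. by apply: measurable_funM => //; apply: measurable_funB. Qed.

(** The cells cover exactly [0, 1[, so the default 0 is taken only outside the support of the
    measure. *)
Let shift (x : T) : T := if `[< exists j, cell j x >] then rescale (digit x) x else 0.

Let mdigit : measurable_fun setT digit.
Proof.
apply: (@measurable_piecewise _ _ _ _ cell (fun j => cst j) 0%N) => //.
Qed.

Let mshift : measurable_fun setT shift.
Proof.
apply: (@measurable_piecewise _ _ _ _ cell rescale 0) => // [j x cj|x nc].
  by rewrite /shift asboolT ?(digitE cj)//; exists j.
by rewrite /shift asboolF// => -[j /nc].
Qed.

Let m01 : measurable (`[0, 1[%classic : set T).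
Proof. exact: measurable_itv. Qed.

Definition unit_interval_measure := mrestr (@lebesgue_measure R) m01.
HB.instance Definition _ := Measure.on unit_interval_measure.

Let mu := unit_interval_measure.

Let mu1 : mu setT = 1%E.
Proof.
by rewrite /mu /unit_interval_measure /mrestr setTI lebesgue_measure_itv/= lte01 sube0.
Qed.

HB.instance Definition _ := @Measure_isProbability.Build _ _ R unit_interval_measure mu1.

Let mu_cell j (V : set T) : measurable V ->
  lebesgue_measure (cell j `&` [set x | V (rescale j x)]) = ((v j)%:E * mu V)%E.
Proof.
(* If [v j] is 0 the cell is empty; this separates the case in which [rescale] divides by 0. *)
move=> mV; have [vj0|vj0] := eqVneq (v j) 0.
  rewrite vj0 mul0e (_ : _ `&` _ = set0) ?measure0//.
  apply/seteqP; split => // x [/= /andP[a b] _].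
  by move: b; rewrite FS vj0 addr0 ltNge a.
have vj : 0 < v j by rewrite lt0r vj0 v0.
rewrite /mu /unit_interval_measure /mrestr.
rewrite -(lebesgue_measure_affine (F j))//; last exact: measurableI.
congr lebesgue_measure; apply/seteqP; split => x /=.
  move=> [/andP[a b] Vx]; split => //; rewrite in_itv/= ler_pdivlMr// ltr_pdivrMr//.
  by rewrite FS in b; apply/andP; split; lra.
move=> [Vx]; rewrite in_itv/= ler_pdivlMr// ltr_pdivrMr// => /andP[a b]; split => //.
by rewrite /cell/= FS; apply/andP; split; lra.
Qed.

Let mass (U : set nat) : \bar R := (\sum_(0 <= j <oo | j \in U) (v j)%:E)%E.

Let mu_step (U : set nat) (V : set T) : measurable V ->
  mu [set x | U (digit x) /\ V (shift x)] = (mass U * mu V)%E.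
Proof.
move=> mV; rewrite {1}/mu /unit_interval_measure /mrestr.
rewrite (_ : _ `&` _ = \bigcup_(j in U) (cell j `&` [set x | V (rescale j x)])); last first.
  apply/seteqP; split => x /=.
    rewrite in_itv/= => -[[Ux Vx] x01]; have [j cj] := cell_cover x01.
    exists j; first by rewrite /= -(digitE cj).
    by split => //=; move: Vx; rewrite /shift asboolT ?(digitE cj)//; exists j.
  move=> [j Uj [cj Vx]]; split; last by rewrite in_itv/=; exact: cell01 cj.
  split; first by rewrite (digitE cj).
  by rewrite /shift asboolT ?(digitE cj)//; exists j.
rewrite measure_bigcup//=; last 2 first.
- move=> j _; apply: measurableI => //.
  by rewrite -[X in measurable X]setTI; exact: mrescale.
- by apply/trivIsetP => i j _ _ ij; apply/seteqP; split => // x [[ci _] [cj _]];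
    move: ij; rewrite (cell_uniq ci cj) eqxx.
under eq_eseriesr do rewrite mu_cell//.
have muV : mu V \is a fin_num by exact: fin_num_measure.
rewrite /mass -(fineK muV); under eq_eseriesr do rewrite muleC.
rewrite nneseriesZl; first exact: muleC.
by move=> i _; rewrite lee_fin.
Qed.

Let massT : mass setT = 1%E.
Proof. by rewrite /mass -v1; apply: eq_eseriesl => i; rewrite in_setT. Qed.

Let miter t : measurable_fun setT (fun x => iter t shift x).
Proof. by elim: t => [|t IH] //=; exact: measurableT_comp. Qed.

Definition digits (x : T) : selections := fun t => digit (iter t shift x).

Let mdigits : measurable_fun setT digits.
Proof. by apply: measurable_seq_space => t; exact: measurableT_comp. Qed.

Let mbox n (U : nat -> set nat) :
  measurable [set x | forall t, (t < n)%N -> U t (digits x t)].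
Proof.
by have := mdigits measurableT (@measurable_box _ nat (fun=> I) n U); rewrite setTI.
Qed.

Let mu_box n (U : nat -> set nat) :
  mu [set x | forall t, (t < n)%N -> U t (digits x t)] = (\prod_(t < n) mass (U t))%E.
Proof.
elim: n U => [|n IH] U.
  by rewrite big_ord0 -mu1; congr (mu _); apply/seteqP; split.
rewrite big_ord_recl/= -(IH (fun t => U t.+1)) -mu_step//; last exact: (mbox n (fun t => U t.+1)).
congr (mu _); apply/seteqP; split => x /=.
  move=> H; split; first exact: (H 0%N).
  by move=> t tn; have := H t.+1 tn; rewrite /digits iterSr.
by move=> [H0 H] [|t] tn //; rewrite /digits iterSr; exact: H.
Qed.

Let mu_coord t (U : set nat) : mu [set x | U (digits x t)] = mass U.
Proof.
elim: t => [|t IH].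
  rewrite -[RHS]mule1 -mu1 -mu_step//; congr (mu _).
  by apply/seteqP; split => x //= [].
rewrite -IH -[RHS]mul1e -massT -mu_step//.
  by congr (mu _); apply/seteqP; split => x /=; rewrite /digits iterSr; tauto.
have := mdigits measurableT (@measurable_coord_set _ nat (fun=> I) t U).
by rewrite setTI.
Qed.

HB.instance Definition _ := isMeasurableFun.Build _ _ _ _ digits mdigits.

Lemma independent_sampling : exists Q : probability selections R,
  [/\ independent_coordinates Q,
      forall t U, Q [set r | U (r t)] = Q [set r | U (r 0%N)] &
      forall j, Q [set r | r 0%N = j] = (v j)%:E].
Proof.
exists (distribution (unit_interval_measure : probability T R) digits); split.
- move=> n U; apply: (etrans (mu_box n U)).
  by apply: eq_bigr => t _; exact: esym (mu_coord t (U t)).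
- by move=> t U; exact: etrans (mu_coord t U) (esym (mu_coord 0 U)).
- move=> j; apply: etrans (mu_coord 0 [set j]) _.
  rewrite /mass (nneseriesD1 (n := j))//; last 2 first.
  + by move=> i _; rewrite lee_fin.
  + by rewrite in_set1.
  rewrite eseries0 ?adde0// => i _.
  by rewrite in_set1 => /andP[/eqP -> /eqP].
Qed.

End independent_sampling.

(** * Strategies that sample the rank of an open channel *)

Lemma infinite_set_nat_ge (D : set nat) (m : nat) :
  infinite_set D -> exists2 k, (m <= k)%N & D k.
Proof.
move=> iD; apply: contrapT => H; apply: iD.
apply: (@sub_finite_set _ _ `I_m) => [k Dk /=|]; last exact: finite_II.
by rewrite ltnNge; apply/negP => mk; apply: H; exists k.
Qed.

Section open_channels.
Variable A : env.

Lemma open_rankS i : open_rank A i.+1 = (open_rank A i + A i.+1)%N.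
Proof. by rewrite /open_rank big_ord_recr. Qed.

Lemma open_rank_leq i j : (i <= j)%N -> (open_rank A i <= open_rank A j)%N.
Proof.
move/subnK <-; elim: (j - i)%N => [|k IH] //.
by rewrite addSn open_rankS (leq_trans IH)// leq_addr.
Qed.

Lemma open_rank_ltn i j : (i < j)%N -> A j -> (open_rank A i < open_rank A j)%N.
Proof.
case: j => // j; rewrite ltnS => ij Aj.
by rewrite open_rankS Aj addn1 ltnS open_rank_leq.
Qed.

Lemma open_rank_inj i j : A i -> A j -> open_rank A i = open_rank A j -> i = j.
Proof.
move=> Ai Aj e; case: (ltngtP i j) => // [/open_rank_ltn/(_ Aj)|/open_rank_ltn/(_ Ai)].
  by rewrite e ltnn.
by rewrite e ltnn.
Qed.

(** The rank grows by at most one per channel, so the first channel whose rank reaches r + 1 is open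
    and has exactly this rank. *)
Lemma open_rank_surj r : infinite_set [set i | A i] ->
  exists i, A i /\ open_rank A i = r.+1.
Proof.
move=> iA.
have unb m : exists i, (m <= open_rank A i)%N.
  elim: m => [|m [i IH]]; first by exists 0%N.
  have [k ik Ak] := infinite_set_nat_ge i.+1 iA.
  by exists k; exact: leq_ltn_trans IH (open_rank_ltn ik Ak).
case: (ex_minnP (unb r.+1)) => i ri imin; exists i.
case: i ri imin => [|i] ri imin.
  move: ri; rewrite /open_rank big_ord_recr big_ord0 /= add0n.
  by case: (A 0%N) => //; case: r imin.
have : ~~ (r.+1 <= open_rank A i)%N by apply/negP => /imin; rewrite ltnn.
rewrite -leqNgt => ir; move: ri; rewrite open_rankS.
case: (A i.+1) => /=; rewrite ?addn1 ?addn0 => ri.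
  by split => //; apply/eqP; rewrite eqSS eqn_leq ir -ltnS.
by move: (leq_trans ri ir); rewrite ltnn.
Qed.

(** Counts from 0, whereas [open_rank] counts from 1. Channel 0 is the default if A has too few open
    channels. *)
Definition open_channel (r : nat) : nat :=
  xget 0%N [set i | A i /\ open_rank A i = r.+1].

Lemma open_channelE r i : A i -> open_rank A i = r.+1 -> open_channel r = i.
Proof.
move=> Ai ri; apply: xget_unique => // j [Aj rj].
by apply: open_rank_inj => //; rewrite ri.
Qed.

End open_channels.

Lemma measurable_env_bit (i : nat) (b : bool) : measurable [set A : env | A i = b].
Proof. exact: (@measurable_coord_set _ bool (fun=> I) i [set b]). Qed.

Lemma measurable_open_count (n k : nat) :
  measurable [set A : env | (\sum_(i < n) A i)%N = k].
Proof.
elim: n k => [|n IH] k.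
  case: k => [|k].
    by rewrite (_ : mkset _ = setT)//; apply/seteqP; split => A //= _; rewrite big_ord0.
  by rewrite (_ : mkset _ = set0)//; apply/seteqP; split => A //=; rewrite big_ord0.
rewrite (_ : mkset _ =
  ([set A : env | A n = false] `&` [set A : env | (\sum_(i < n) A i)%N = k]) `|`
  ([set A : env | A n = true] `&` [set A : env | (\sum_(i < n) A i).+1%N = k])).
  apply: measurableU; apply: measurableI => //; try exact: measurable_env_bit.
  case: k => [|k].
    by rewrite (_ : mkset _ = set0)//; apply/seteqP; split.
  rewrite (_ : mkset _ = [set A : env | (\sum_(i < n) A i)%N = k])//.
  by apply/seteqP; split => A /=; [case|move=> ->].
apply/seteqP; split => A /=; rewrite big_ord_recr/=.
  by case An: (A n) => /=; rewrite ?addn1 ?addn0; [right|left].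
by case=> -[-> <-] /=; rewrite ?addn1 ?addn0.
Qed.

Lemma measurable_open_channel r : measurable_fun setT (fun A : env => open_channel A r).
Proof.
apply: (@measurable_piecewise _ _ _ _
  (fun i => [set A : env | A i = true] `&` [set A | open_rank A i = r.+1])
  (fun i => cst i) 0%N) => //.
- move=> i; apply: measurableI; first exact: measurable_env_bit.
  exact: measurable_open_count.
- by move=> i A [/= Ai ri]; exact: open_channelE.
- by move=> A H; apply: xgetPN => i [Ai ri]; exact: (H i).
Qed.

(** Ranks are drawn from one law that ignores A and are then translated into channels, so
    measurability of the strategy in A follows from joint measurability of this map. *)
Definition play_ranks (A : env) (r : selections) : selections :=
  fun t => open_channel A (r t).

Lemma measurable_play_ranks :
  measurable_fun setT (fun x : env * selections => play_ranks x.1 x.2).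
Proof.
apply: measurable_seq_space => t.
apply: (@measurable_piecewise _ _ _ _ (fun j => snd @^-1` [set r : selections | r t = j])
  (fun j x => open_channel x.1 j) 0%N).
- move=> j; rewrite -[X in measurable X]setTI; apply: measurable_snd => //.
  exact: (@measurable_coord_set _ nat (fun=> I) t [set j]).
- by move=> j; apply: (measurableT_comp (measurable_open_channel j)); exact: measurable_fst.
- by move=> j x /= <-.
- by move=> x /(_ (x.2 t)) /=.
Qed.

Section rank_strategy.
Context (R : realType) (Q : probability selections R).

Let mplay (A : env) : measurable_fun setT (play_ranks A).
Proof. exact: (measurable_fun_pair2 A measurable_play_ranks). Qed.

HB.instance Definition _ (A : env) := isMeasurableFun.Build _ _ _ _
  (play_ranks A) (mplay A).

Definition rank_strategy (A : env) : {measure set selections -> \bar R} :=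
  distribution Q (play_ranks A).

Let mrank_strategy (U : set selections) : measurable U ->
  measurable_fun setT (rank_strategy ^~ U).
Proof.
move=> mU.
pose V := (fun x : env * selections => play_ranks x.1 x.2) @^-1` U.
have mV : measurable V.
  by rewrite -[X in measurable X]setTI; exact: measurable_play_ranks.
apply: (eq_measurable_fun (Q \o xsection V)); last exact: measurable_fun_xsection.
move=> A _ /=; rewrite /rank_strategy /distribution /pushforward; congr (Q _).
by apply/seteqP; split => r /=; rewrite /xsection/= inE.
Qed.

HB.instance Definition _ := isKernel.Build _ _ _ _ _ rank_strategy mrank_strategy.

Let prob_rank_strategy A : rank_strategy A setT = 1%E.
Proof. exact: probability_setT. Qed.

HB.instance Definition _ := Kernel_isProbability.Build _ _ _ _ _
  rank_strategy prob_rank_strategy.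

End rank_strategy.

(** The shift to [w j.+1] matches values sampled from 0 with ranks counted from 1. *)
Lemma fixed_strategy_exists (R : realType) (w : nat -> R) :
  (forall j, 0 <= w j.+1) -> (\sum_(j <oo) (w j.+1)%:E = 1)%E ->
  exists k : strategy R, fixed k /\ plays_weights w k.
Proof.
move=> w0 w1; have [Q [indQ statQ Qw]] := independent_sampling w0 w1.
exists (rank_strategy Q : strategy R); split; first split.
- move=> A t; apply/funext => U.
  exact: (statQ t (fun r => U (open_channel A r))).
- by move=> A n U; exact: (indQ n (fun t r => U t (open_channel A r))).
- move=> A iA i.
  have -> : slot_law (rank_strategy Q : strategy R) 0 A [set i] =
    Q [set r | open_channel A (r 0%N) = i] by [].
  case: ifP => Ai.
    have ri : open_rank A i = (open_rank A i).-1.+1 by rewrite prednK// open_rank_gt0.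
    rewrite ri -Qw; congr (Q _); apply/seteqP; split => r /=; last first.
      by move=> e; apply: open_channelE => //; rewrite e.
    have [j [Aj rj]] := open_rank_surj (r 0%N) iA.
    by rewrite (open_channelE Aj rj) => e; rewrite -e rj.
  (* A closed channel is never selected, since every sampled rank belongs to some open channel. *)
  rewrite (_ : mkset _ = set0) ?measure0//; apply/seteqP; split => // r /=.
  have [j [Aj rj]] := open_rank_surj (r 0%N) iA.
  by rewrite (open_channelE Aj rj) => e; rewrite e Ai in Aj.
Qed.

(** * Geometric weights *)

Lemma nneseries_EFin (R : realType) (u : nat -> R) (l : R) :
  (fun n => \sum_(0 <= k < n) u k) @ \oo --> l ->
  (\sum_(k <oo) (u k)%:E = l%:E)%E.
Proof.
move=> ul; rewrite -(cvg_lim _ ul)// -EFin_lim; last by apply/cvg_ex; exists l.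
by congr (limn _); apply/funext => n /=; rewrite sumEFin.
Qed.

Lemma geometric_weight_gt0 (R : realType) (theta : R) (j : nat) :
  0 < theta < 1 -> 0 < geometric_weight theta j.
Proof.
by move=> /andP[t0 t1]; rewrite /geometric_weight mulr_gt0// exprn_gt0// subr_gt0.
Qed.

Lemma geometric_weight_sum (R : realType) (theta : R) : 0 < theta < 1 ->
  (\sum_(j <oo) (geometric_weight theta j.+1)%:E = 1)%E.
Proof.
move=> /andP[t0 t1]; apply: nneseries_EFin.
have n1 : `|1 - theta| < 1 by rewrite ger0_norm; lra.
have := @cvg_geometric_series R theta (1 - theta) n1.
rewrite subKr divff ?gt_eqF// => h.
rewrite (_ : (fun n => _) = series (geometric theta (1 - theta)))//.
apply/funext => n; rewrite /series /=; apply: eq_bigr => k _.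
by rewrite /geometric_weight /= mulrC.
Qed.

(** After 2 a b <= a^2 + b^2 the squares are absorbed by (1 - x/6)^2 >= 1 - x/3, which relates the 6
    of the weights to the 3 of the rank moments. The constant 18 is 6 * 6 / 2. *)
Lemma geometric_weight_inv_le (R : realType) (u v : R) (i j : nat) :
  0 < u <= 1 -> 0 < v <= 1 -> (0 < i)%N -> (0 < j)%N ->
  (geometric_weight (u / 6) i * geometric_weight (v / 6) j)^-1 <=
  18 / (u * v) * ((1 - u / 3)^-1 ^+ i + (1 - v / 3)^-1 ^+ j).
Proof.
case: i j => [|i] [|j] // /andP[u0 u1] /andP[v0 v1] _ _.
rewrite /geometric_weight /=.
have inv_sq (x : R) k : 0 < x <= 1 -> ((1 - x / 6)^-1 ^+ k) ^+ 2 <= (1 - x / 3)^-1 ^+ k.+1.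
  move=> /andP[x0 x1].
  have d : 0 < 1 - x / 3 by lra.
  have z1 : 1 <= (1 - x / 3)^-1 by rewrite invf_ge1//; lra.
  apply: (@le_trans _ _ ((1 - x / 3)^-1 ^+ k)); last by rewrite ler_weXn2l.
  rewrite -exprM mulnC exprM; apply: lerXn2r.
  - by rewrite nnegrE exprn_ge0// invr_ge0; lra.
  - by rewrite nnegrE invr_ge0 ltW.
  rewrite exprVn lef_pV2 ?posrE//; last by rewrite exprn_gt0//; lra.
  by rewrite expr2; nra.
have -> : ((1 - u / 6) ^+ i * (u / 6) * ((1 - v / 6) ^+ j * (v / 6)))^-1 =
    36 / (u * v) * ((1 - u / 6)^-1 ^+ i * (1 - v / 6)^-1 ^+ j).
  have iu : (1 - u / 6) ^+ i != 0 by rewrite expf_neq0// gt_eqF//; lra.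
  have iv : (1 - v / 6) ^+ j != 0 by rewrite expf_neq0// gt_eqF//; lra.
  rewrite !exprVn; field; by rewrite iu iv !gt_eqF.
have -> : 18 / (u * v) = 36 / (u * v) / 2 by field; rewrite !gt_eqF.
rewrite -[leRHS]mulrA; apply: ler_wpM2l.
  by rewrite divr_ge0// ltW// mulr_gt0.
have hu := inv_sq u i; have hv := inv_sq v j.
rewrite u0 u1 in hu; rewrite v0 v1 in hv.
have := hu isT; have := hv isT; set a := (1 - u / 6)^-1 ^+ i; set b := (1 - v / 6)^-1 ^+ j.
by move=> hb ha; have := sqr_ge0 (a - b); rewrite sqrrB; lra.
Qed.

(** * Logarithmic weights *)

(** In x = u i the left side grows polynomially, up to a power of [Lam], while the last factor is at
    least exp (x / 3). The integer m bounds the degree 1 + al. *)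
Lemma log_moment_le (R : realType) (al u p : R) (m i : nat) :
  0 <= al -> 0 < p -> p <= u -> u <= 1 ->
  (0 < m)%N -> 1 + al <= m%:R ->
  (u * (i%:R * ln i.+1%:R `^ al)) ^+ 2 <=
  (6 * m%:R) ^+ (2 * m) * expR 3^-1 * ln (expR 1 / p) `^ (al * 2) *
    (1 - u / 3)^-1 ^+ i.
Proof.
move=> al0 p0 pu u1 m0 etam; have u0 : 0 < u by exact: lt_le_trans pu.
set Lam := ln (expR 1 / p); pose x := u * i%:R.
have LE : Lam = 1 - ln p by rewrite /Lam ln_div ?posrE ?expR_gt0// expRK.
have lp : ln p <= 0 by apply: ln_le0; exact: le_trans u1.
have L1 : 1 <= Lam by lra.
have x0 : 0 <= x by rewrite mulr_ge0// ltW.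
have li0 : 0 <= ln i.+1%:R :> R by rewrite ln_ge0// ler1n.
(* From p <= u one gets i + 1 <= (1 + x) / p; then ln (1 + x) <= x, and [Lam] >= 1 absorbs x. *)
have lnb : ln i.+1%:R <= Lam * (1 + x).
  have h1 : ln i.+1%:R <= ln ((1 + x) / p).
    rewrite ler_ln ?posrE ?ltr0n ?divr_gt0 ?ltr_pwDl// ler_pdivlMr//.
    rewrite -natr1 mulrDl mul1r.
    have : i%:R * p <= x by rewrite /x mulrC ler_wpM2r.
    by lra.
  have h2 : ln (1 + x) <= x by apply: le_ln1Dx; lra.
  rewrite ln_div ?posrE ?ltr_pwDl// in h1.
  have : x <= Lam * x by rewrite ler_peMl.
  by lra.
have x1 : 1 <= 1 + x by lra.
have b1 : u * (i%:R * ln i.+1%:R `^ al) <= Lam `^ al * (1 + x) ^+ m.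
  rewrite mulrA -/x.
  apply: (@le_trans _ _ (x * (Lam `^ al * (1 + x) `^ al))).
    apply: ler_wpM2l => //; rewrite -powRM; [|lra|lra].
    apply: ge0_ler_powR => //; rewrite nnegrE//.
    by apply: mulr_ge0; lra.
  rewrite mulrCA; apply: ler_wpM2l; first exact: powR_ge0.
  apply: (@le_trans _ _ ((1 + x) `^ (1 + al))).
    rewrite [leRHS]powRD; last by rewrite (@gt_eqF _ _ (1 + x)) ?implybT//; lra.
    rewrite powRr1; last by lra.
    by apply: ler_wpM2r; [exact: powR_ge0|lra].
  by rewrite -powR_mulrn; [exact: ler_powR|lra].
have b0 : 0 <= u * (i%:R * ln i.+1%:R `^ al).
  by rewrite !mulr_ge0 ?powR_ge0// ltW.
apply: (@le_trans _ _ ((Lam `^ al * (1 + x) ^+ m) ^+ 2)).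
  by apply: lerXn2r; rewrite ?nnegrE// (le_trans b0).
rewrite exprMn -exprM mulnC.
have -> : (Lam `^ al) ^+ 2 = Lam `^ (al * 2).
  by rewrite -powR_mulrn ?powR_ge0// -powRrM.
set k := (2 * m)%N.
have k0 : (0 : R) < k%:R by rewrite ltr0n /k muln_gt0.
have kE : 6 * m%:R = 3 * k%:R :> R by rewrite /k natrM; ring.
(* The k-th power of y <= exp y at y = (1 + x) / (3 k); the base 6 m is 3 k. *)
have b2 : (1 + x) ^+ k <= (6 * m%:R) ^+ k * expR ((1 + x) / 3).
  have -> : (1 + x) / 3 = k%:R * ((1 + x) / 3 / k%:R) by field; rewrite gt_eqF.
  rewrite expRM_natl -exprMn kE; apply: lerXn2r; rewrite ?nnegrE; [lra| |].
    by rewrite !mulr_ge0 ?expR_ge0.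
  have := expR_ge1Dx ((1 + x) / 3 / k%:R); set y := (1 + x) / 3 / k%:R => h.
  have -> : 1 + x = 3 * k%:R * y by rewrite /y; field; rewrite gt_eqF.
  by apply: ler_wpM2l; [rewrite mulr_ge0|lra].
have b3 : expR ((1 + x) / 3) <= expR 3^-1 * (1 - u / 3)^-1 ^+ i.
  have -> : (1 + x) / 3 = 3^-1 + i%:R * (u / 3) by rewrite /x; field.
  rewrite expRD expRM_natl; apply: ler_wpM2l; first exact: expR_ge0.
  apply: lerXn2r; rewrite ?nnegrE ?expR_ge0//; first by rewrite invr_ge0; lra.
  have -> : expR (u / 3) = (expR (- (u / 3)))^-1 by rewrite -expRN opprK.
  rewrite lef_pV2 ?posrE ?expR_gt0//; last by lra.
  by have := expR_ge1Dx (- (u / 3)); lra.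
have pk : 0 <= (6 * m%:R) ^+ k :> R by rewrite exprn_ge0// mulr_ge0.
set P := (6 * m%:R) ^+ k in b2 pk *; set L := Lam `^ _; set z := _^-1 ^+ i in b3 *.
have -> : P * expR 3^-1 * L * z = L * (P * (expR 3^-1 * z)) by ring.
apply: ler_wpM2l; first exact: powR_ge0.
by apply: (le_trans b2); exact: ler_wpM2l.
Qed.

Section logarithmic_weights.
Context (R : realType) (eps : R).
Hypothesis eps0 : 0 < eps.
Let eta := eps / 2.
Let eta0 : 0 < eta. Proof. by rewrite /eta divr_gt0. Qed.

(** Two tangent-line bounds: exp s >= 1 + s at s = h (ln a - ln b), and ln (b / a) <= b / a - 1. *)
Lemma powRN_diff_ge (h a b : R) : 0 < h -> 0 < a -> 0 < b ->
  a `^ (- h) * (h * ((a - b) / a)) <= b `^ (- h) - a `^ (- h).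
Proof.
move=> h0 a0 b0; rewrite /powR !gt_eqF//.
have -> : expR (- h * ln b) = expR (- h * ln a) * expR (h * (ln a - ln b)).
  by rewrite -expRD; congr expR; ring.
set A := expR (- h * ln a); set B := expR _.
have -> : A * B - A = A * (B - 1) by ring.
apply: ler_wpM2l; rewrite /A /B; first exact: expR_ge0.
have : (a - b) / a <= ln a - ln b.
  have ba : -1 < b / a - 1 by rewrite ltrBrDr addNr divr_gt0.
  have := le_ln1Dx ba; rewrite addrC subrK ln_div ?posrE// mulrBl divff ?gt_eqF//.
  by lra.
move=> /(ler_wpM2l (ltW h0)); have := expR_ge1Dx (h * (ln a - ln b)); lra.
Qed.

Lemma ln_nat_gt0 (j : nat) : (0 < j)%N -> 0 < ln j.+1%:R :> R.
Proof. by move=> j0; rewrite ln_gt0// ltr1n ltnS. Qed.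

Lemma log_weight_raw_gt0 j : (0 < j)%N -> 0 < log_weight_raw eps j.
Proof.
move=> j0; rewrite /log_weight_raw invr_gt0 mulr_gt0 ?ltr0n// powR_gt0//.
exact: ln_nat_gt0.
Qed.

Lemma log_weight_raw_ge0 j : 0 <= log_weight_raw eps j.
Proof. by rewrite /log_weight_raw invr_ge0 mulr_ge0// powR_ge0. Qed.

(* This makes the sum telescope. *)
Lemma log_weight_raw_le j : (1 < j)%N ->
  log_weight_raw eps j <= 2 / eta * (ln j%:R `^ (- eta) - ln j.+1%:R `^ (- eta)).
Proof.
move=> j1; have j0 : (0 < j)%N by exact: ltnW.
set a := ln j.+1%:R; set b := ln j%:R.
have a0 : 0 < a by exact: ln_nat_gt0.
have b0 : 0 < b by rewrite ln_gt0// ltr1n.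
have jR : (0 : R) < j%:R by rewrite ltr0n.
have ab : j.+1%:R^-1 <= a - b.
  have x1 : -1 < (j%:R / j.+1%:R - 1 : R) by rewrite ltrBrDr addNr divr_gt0.
  have := le_ln1Dx x1; rewrite addrC subrK ln_div ?posrE ?ltr0n// -/a -/b.
  have -> : (j%:R / j.+1%:R - 1 : R) = - j.+1%:R^-1.
    by rewrite -natr1; field; rewrite gt_eqF// natr1 ltr0n.
  by move=> h; rewrite -[leLHS]opprK lerNl opprB.
(* The factor 2 pays for replacing 1 / j by 1 / (j + 1), which is at most ln (j + 1) - ln j. *)
have jj : j%:R^-1 <= 2 * (a - b).
  apply: (@le_trans _ _ (2 * j.+1%:R^-1)); last by rewrite ler_wpM2l.
  rewrite -[leLHS]mul1r ler_pdivrMr// mulrAC ler_pdivlMr ?ltr0n// mul1r -natr1.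
  have : (1 : R) <= j%:R by rewrite ler1n.
  by lra.
have D := powRN_diff_ge eta0 a0 b0.
apply: (@le_trans _ _ (2 / eta * (a `^ (- eta) * (eta * ((a - b) / a))))); last first.
  by apply: ler_wpM2l => //; rewrite divr_ge0// ltW.
rewrite /log_weight_raw -/a -/eta powRD; last by rewrite (gt_eqF a0) implybT.
rewrite powRr1; last exact: ltW.
rewrite powRN.
have pa : 0 < a `^ eta by rewrite powR_gt0.
have -> : 2 / eta * ((a `^ eta)^-1 * (eta * ((a - b) / a))) =
    2 * (a - b) * (a * a `^ eta)^-1.
  by field; rewrite !gt_eqF.
rewrite invfM; apply: ler_wpM2r => //.
by rewrite invr_ge0 mulr_ge0// ltW.
Qed.

Let S (n : nat) : R := \sum_(1 <= i < n) log_weight_raw eps i.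

Let S_nondecreasing : {homo S : n m / (n <= m)%N >-> n <= m}.
Proof.
apply/nondecreasing_seqP => n; rewrite /S; case: n => [|n].
  by rewrite !big_geq.
by rewrite [leRHS]big_nat_recr//= lerDl log_weight_raw_ge0.
Qed.

(** The term of index 1 is kept apart because telescoping needs ln j > 0. *)
Let S_bound n : S n.+2 <= log_weight_raw eps 1 +
  2 / eta * (ln 2%:R `^ (- eta) - ln n.+2%:R `^ (- eta)).
Proof.
elim: n => [|n IH]; first by rewrite /S big_nat1 subrr mulr0 addr0.
rewrite /S big_nat_recr//=; apply: (le_trans (lerD IH (log_weight_raw_le _))) => //.
by rewrite -addrA lerD2l -mulrDr; apply: ler_wpM2l; [rewrite divr_ge0// ltW|lra].
Qed.

Let is_cvg_S : cvgn S.
Proof.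
apply: nondecreasing_is_cvgn => //.
exists (log_weight_raw eps 1 + 2 / eta * ln 2%:R `^ (- eta)) => _ [n _ <-].
apply: (@le_trans _ _ (S n.+2)); first by apply: S_nondecreasing; rewrite -addn2 leq_addr.
apply: (le_trans (S_bound n)); rewrite lerD2l; apply: ler_wpM2l.
  by rewrite divr_ge0// ltW.
by rewrite gerBl powR_ge0.
Qed.

Let Z := limn S.

Lemma log_weight_norm_gt0 : 0 < limn (fun n => \sum_(1 <= i < n) log_weight_raw eps i).
Proof.
apply: (@lt_le_trans _ _ (S 2)); first by rewrite /S big_nat1 log_weight_raw_gt0.
exact: nondecreasing_cvgn_le.
Qed.

Lemma log_weight_gt0 j : (0 < j)%N -> 0 < log_weight eps j.
Proof.
by move=> j0; rewrite /log_weight divr_gt0 ?log_weight_norm_gt0 ?log_weight_raw_gt0.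
Qed.

Lemma log_weight_sum : (\sum_(j <oo) (log_weight eps j.+1)%:E = 1)%E.
Proof.
apply: nneseries_EFin.
rewrite (_ : (fun n => _) = (fun n => S n.+1 / Z)); last first.
  apply/funext => n; rewrite /S big_add1/= mulr_suml; exact: eq_bigr.
rewrite -[X in _ --> X](divff (x := Z)); last by rewrite gt_eqF// log_weight_norm_gt0.
have h : S n @[n --> \oo] --> Z := is_cvg_S.
rewrite -(cvg_shiftS S) in h.
exact: cvgMl h.
Qed.

End logarithmic_weights.

(** By 2 x y <= x^2 + y^2 it reduces to [log_moment_le] for each party with al = 1 + eps / 2, so the
    logarithm gets the exponent 2 al = 2 + eps. *)
Lemma log_weight_inv_le (R : realType) (eps : R) : 0 < eps ->
  exists2 C : R, 0 < C & forall u v p : R, 0 < p ->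
    p <= u -> u <= 1 -> p <= v -> v <= 1 ->
    forall i j, (0 < i)%N -> (0 < j)%N ->
    (log_weight eps i * log_weight eps j)^-1 <=
      C / (u * v) * ln (expR 1 / p) `^ (2 + eps) *
      ((1 - u / 3)^-1 ^+ i + (1 - v / 3)^-1 ^+ j).
Proof.
move=> eps0; set Z := limn (fun n => \sum_(1 <= i < n) log_weight_raw eps i).
have Z0 : 0 < Z by exact: log_weight_norm_gt0.
pose al := 1 + eps / 2.
have al0 : 0 <= al by rewrite /al; lra.
pose m := (Num.truncn (1 + al)).+1.
have mal : 1 + al <= m%:R by exact/ltW/truncnS_gt.
pose C1 : R := (6 * m%:R) ^+ (2 * m) * expR 3^-1.
have C10 : 0 < C1 by rewrite mulr_gt0 ?expR_gt0// exprn_gt0// mulr_gt0// ltr0n.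
exists (Z ^+ 2 * C1 / 2); first by rewrite divr_gt0// mulr_gt0// exprn_gt0.
move=> u v p p0 pu u1 pv v1 i j i0 j0.
have u0 : 0 < u by exact: lt_le_trans pu.
have v0 : 0 < v by exact: lt_le_trans pv.
have ha := @log_moment_le R al u p m i al0 p0 pu u1 isT mal.
have hb := @log_moment_le R al v p m j al0 p0 pv v1 isT mal.
have -> : 2 + eps = al * 2 by rewrite /al; field.
set L := ln (expR 1 / p) `^ (al * 2) in ha hb *.
set za := _^-1 ^+ i in ha *; set zb := _^-1 ^+ j in hb *.
rewrite -/C1 in ha hb.
set wa := i%:R * _ in ha; set wb := j%:R * _ in hb.
have wa0 : 0 < wa by rewrite mulr_gt0 ?ltr0n// powR_gt0// ln_nat_gt0.
have wb0 : 0 < wb by rewrite mulr_gt0 ?ltr0n// powR_gt0// ln_nat_gt0.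
have -> : (log_weight eps i * log_weight eps j)^-1 =
    Z ^+ 2 / (u * v) * ((u * wa) * (v * wb)).
  rewrite /log_weight -/Z /log_weight_raw -/al -/wa -/wb.
  by field; rewrite !gt_eqF.
have -> : Z ^+ 2 * C1 / 2 / (u * v) * L * (za + zb) =
    Z ^+ 2 / (u * v) * ((C1 * L * za + C1 * L * zb) / 2).
  by field; rewrite !gt_eqF.
apply: ler_wpM2l; first by rewrite divr_ge0 ?exprn_ge0 ?mulr_ge0// ltW.
by have := sqr_ge0 (u * wa - v * wb); rewrite sqrrB; lra.
Qed.

Lemma mulr_itv01 (R : realType) (x y : R) : 0 < x <= 1 -> 0 < y <= 1 -> 0 < x * y <= 1.
Proof.
by move=> /andP[x0 x1] /andP[y0 y1]; rewrite mulr_gt0//= mulr_ile1// ltW.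
Qed.

Theorem theorem1 (R : realType) :
  [/\ exists C : R, 0 < C /\
        forall p1 p2 q : R,
          0 < p1 <= 1 -> 0 < p2 <= 1 -> 0 < q <= 1 ->
          (exists ka kb : strategy R,
            [/\ fixed ka, fixed kb,
                plays_weights (geometric_weight (p2 * q / 6)) ka &
                plays_weights (geometric_weight (p1 * q / 6)) kb]) /\
          forall ka kb : strategy R,
            fixed ka -> fixed kb ->
            plays_weights (geometric_weight (p2 * q / 6)) ka ->
            plays_weights (geometric_weight (p1 * q / 6)) kb ->
            forall PA PB PE : probability env R,
              bernoulli_env p1 PA -> bernoulli_env p2 PB ->
              bernoulli_env q PE ->
              forall s : nat,
                (expected_sync_time PA PB PE ka kb s <=
                  (C / (p1 * p2 * q ^+ 2))%:E)%E,
      forall eps : R, 0 < eps ->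
        exists (ka kb : strategy R) (C : R),
          [/\ fixed ka /\ fixed kb,
              plays_weights (log_weight eps) ka,
              plays_weights (log_weight eps) kb,
              0 < C &
              forall p1 p2 q : R,
                0 < p1 <= 1 -> 0 < p2 <= 1 -> 0 < q <= 1 ->
                forall PA PB PE : probability env R,
                  bernoulli_env p1 PA -> bernoulli_env p2 PB ->
                  bernoulli_env q PE ->
                  forall s : nat,
                    (expected_sync_time PA PB PE ka kb s <=
                      (C / (p1 * p2 * q ^+ 2) *
                       ln (expR 1 / (p1 * p2 * q)) `^ (2 + eps))%:E)%E] &
      exists c : R, 0 < c /\
        forall p1 p2 q : R,
          0 < p1 <= 1 -> 0 < p2 <= 1 -> 0 < q <= 1 ->
          forall ka kb : strategy R,
            stationary ka -> stationary kb ->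
            forall PA PB PE : probability env R,
              bernoulli_env p1 PA -> bernoulli_env p2 PB ->
              bernoulli_env q PE ->
              forall s : nat,
                ((c / (p1 * p2 * q ^+ 2))%:E <=
                  expected_sync_time PA PB PE ka kb s)%E].
Proof.
have theta01 (u : R) : 0 < u <= 1 -> 0 < u / 6 < 1.
  by move=> /andP[u0 u1]; rewrite divr_gt0//= ltr_pdivrMr// mul1r; lra.
split.
(* 72 is 4 * 18, and (p2 q) (p1 q) is the required p1 p2 q^2. *)
- exists 72; split=> // p1 p2 q hp1 hp2 hq.
  have hu := mulr_itv01 hp2 hq; have hv := mulr_itv01 hp1 hq.
  have hu6 := theta01 _ hu; have hv6 := theta01 _ hv.
  split=> [|ka kb fka fkb wka wkb PA PB PE bA bB bE s].
    have [ka [fka wka]] := fixed_strategy_exists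
      (fun j => ltW (geometric_weight_gt0 j.+1 hu6)) (geometric_weight_sum hu6).
    have [kb [fkb wkb]] := fixed_strategy_exists
      (fun j => ltW (geometric_weight_gt0 j.+1 hv6)) (geometric_weight_sum hv6).
    by exists ka, kb.
  have /andP[u0 _] := hu; have /andP[v0 _] := hv.
  have K0 : 0 < 18 / ((p2 * q) * (p1 * q)) by rewrite divr_gt0// mulr_gt0.
  have := expected_sync_time_le hp1 hp2 hq K0 fka fkb wka wkb
    (fun i _ => geometric_weight_gt0 i hu6) (fun i _ => geometric_weight_gt0 i hv6)
    (fun i j i0 j0 => geometric_weight_inv_le hu hv i0 j0) bA bB bE s.
  rewrite (_ : 4 * _ = 72 / (p1 * p2 * q ^+ 2))//.
  case/andP: hp1 hp2 hq => ? _ /andP[? _] /andP[? _].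
  by field; rewrite !gt_eqF.
- move=> eps eps0; have [C C0 HC] := log_weight_inv_le eps0.
  have [k [fk wk]] := fixed_strategy_exists
    (fun j => ltW (log_weight_gt0 eps0 (ltn0Sn j))) (log_weight_sum eps0).
  exists k, k, (4 * C); split=> //; first by rewrite mulr_gt0.
  move=> p1 p2 q hp1 hp2 hq PA PB PE bA bB bE s.
  have hu := mulr_itv01 hp2 hq; have hv := mulr_itv01 hp1 hq.
  have /andP[p0 ple1] := mulr_itv01 (mulr_itv01 hp1 hp2) hq.
  have /andP[u0 u1] := hu; have /andP[v0 v1] := hv.
  have pu : p1 * p2 * q <= p2 * q.
    by rewrite -mulrA; apply: ler_piMl; [exact: ltW|case/andP: hp1].
  have pv : p1 * p2 * q <= p1 * q.
    by rewrite mulrAC; apply: ler_piMr; [exact: ltW|case/andP: hp2].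
  set Lam := ln _ `^ _.
  have L0 : 0 < Lam.
    rewrite powR_gt0// ln_gt0// ltr_pdivlMr// mul1r (le_lt_trans ple1)//.
    by rewrite expR_gt1.
  have K0 : 0 < C / ((p2 * q) * (p1 * q)) * Lam by rewrite !mulr_gt0// invr_gt0 mulr_gt0.
  have := expected_sync_time_le hp1 hp2 hq K0 fk fk wk wk
    (fun i i0 => log_weight_gt0 eps0 i0) (fun i i0 => log_weight_gt0 eps0 i0)
    (HC _ _ _ p0 pu u1 pv v1) bA bB bE s.
  rewrite (_ : 4 * _ = 4 * C / (p1 * p2 * q ^+ 2) * Lam)//.
  case/andP: hp1 hp2 hq => ? _ /andP[? _] /andP[? _].
  by field; rewrite !gt_eqF.
- exists 32^-1; split; first by rewrite invr_gt0.
  by move=> p1 p2 q hp1 hp2 hq ka kb ska skb PA PB PE bA bB bE s;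
    exact: expected_sync_time_ge.
Qed.
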